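(* Let $Z<0$, $N\ge2$ and $n\in\{1,\dots,N-1\}$ be fixed. Assume $\omega>\omega_n^*$. (1) If $2n\le N$, or $2n>N$ and $\omega>2N^2/Z^2$, then $$n(\mathcal L_{+,Z})=n,\qquad n\big(\mathcal L_{+,Z}|_{D(\mathcal H_Z^{\delta'})\cap X_{\mathrm{mean}}}\big)=1.$$ (2) If $2n>N$ and $\omega_n^*<\omega<2N^2/Z^2$, then $$n(\mathcal L_{+,Z})=N-n+1,\qquad n\big(\mathcal L_{+,Z}|_{D(\mathcal H_Z^{\delta'})\cap X_{\mathrm{mean}}}\big)=2.$$ (3) If $2n>N$ and $\omega=2N^2/Z^2$, then $$n(\mathcal L_{+,Z})=n\big(\mathcal L_{+,Z}|_{D(\mathcal H_Z^{\delta'})\cap X_{\mathrm{mean}}}\big)=1.$$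
   Context: Star graph: $\mathcal G$ consists of $N$ half-lines, each identified with $[L,\infty)$, $L\ge 0$, joined at the vertex $x=L$. Functions are $N$-tuples $(\psi_j)_{j=1}^N$; $L^2(\mathcal G)=\bigoplus_{j=1}^N L^2(L,\infty)$, $H^2(\mathcal G)=\bigoplus_{j=1}^N H^2(L,\infty)$, and $$D(\mathcal H_Z^{\delta'})=\Big\{(\psi_j)\in H^2(\mathcal G):\ \psi_1'(L)=\dots=\psi_N'(L),\ \sum_{j=1}^N\psi_j(L)=Z\psi_1'(L)\Big\}.$$ $X_{\mathrm{mean}}=\{\mathbf v\in L^2(\mathcal G): v_1\equiv\dots\equiv v_n,\ v_{n+1}\equiv\dots\equiv v_N\}$. Profiles: for $\omega>0$, $\Psi_a(x)=\sqrt{2\omega}\,\operatorname{sech}(\sqrt\omega(x-L)+a)$, $x\ge L$. Put $\alpha_n(t)=\frac nt+\frac{N-n}{\sqrt{1-t^2}}$, $t\in(0,1)$, with unique minimizer $t_n^*=\big(\frac{n^{2/3}}{n^{2/3}+(N-n)^{2/3}}\big)^{1/2}$, and $\omega_n^*=\alpha_n(t_n^* )^2/Z^2=(n^{2/3}+(N-n)^{2/3})^3/Z^2$. For $\omega>\omega_n^*$ let $t_1$ be the unique element of $(0,t_n^* )$ with $\alpha_n(t_1)=-Z\sqrt\omega$, $t_N=\sqrt{1-t_1^2}$, $a_1=\operatorname{arctanh}t_1$, $a_N=\operatorname{arctanh}t_N$. Operator: $\mathcal L_{+,Z}=\operatorname{diag}(\mathcal L_{+,1},\dots,\mathcal L_{+,1},\mathcal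 L_{+,N},\dots,\mathcal L_{+,N})$ with $\mathcal L_{+,1}$ repeated $n$ times and $\mathcal L_{+,N}$ repeated $N-n$ times, $\mathcal L_{+,j}=-\partial_x^2+\omega-3\Psi_{a_j}^2$ for $j\in\{1,N\}$, with domain $D(\mathcal L_{+,Z})=D(\mathcal H_Z^{\delta'})$; it is self-adjoint in $L^2(\mathcal G)$ and leaves $X_{\mathrm{mean}}$ invariant, so its restriction to $D(\mathcal H_Z^{\delta'})\cap X_{\mathrm{mean}}$ is an operator in $X_{\mathrm{mean}}$. For a self-adjoint $T$, $n(T)$ is the number of negative eigenvalues counted with multiplicity (Morse index). *)

(* Defs.v *)
From HB Require Import structures.
From mathcomp Require Import all_boot all_order all_algebra.
From mathcomp Require Import all_classical all_reals all_analysis.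
From mathcomp Require Import complex.
Set Implicit Arguments.
Unset Strict Implicit.
Unset Printing Implicit Defensive.
Import Order.TTheory GRing.Theory Num.Theory.
Import numFieldNormedType.Exports.
Local Open Scope classical_set_scope.
Local Open Scope ring_scope.
Local Open Scope complex_scope.

(* The Hilbert spaces are complex. An element of a space of functions on
   [L, +oo[ is represented by a function on the whole of R, of which only the
   values on ]L, +oo[ matter; elements of L^2 are compared with "= %[ae]" on
   ]L, +oo[. Measurability, weak derivatives and boundary values of a
   complex-valued function are taken on its real and imaginary parts. *)

Section half_line.
Context {R : realType}.
Implicit Types (L x : R) (f g : R -> R) (u v : R -> R[i]).

Let mu := @lebesgue_measure R.

Definition half_line L : set R := `]L, +oo[.

Definition real_L2 L f := f \_ (half_line L) \in Lfun mu 2%:E.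

(* Test functions are C^1 with compact support, as in Brezis' definition of
   Sobolev spaces on an interval. *)
Definition test_function L f :=
  [/\ forall x, derivable f x 1,
      continuous (derive1 f) &
      exists a b, L < a /\ forall x, f x != 0 -> a <= x <= b].

Definition real_weak_derivative L f g := forall phi, test_function L phi ->
  (\int[mu]_(x in half_line L) (f x * derive1 phi x) =
   - \int[mu]_(x in half_line L) (g x * phi x))%R.

(* c is the value at L of the representative of f continuous on [L, +oo[. *)
Definition real_boundary_value L f (c : R) := exists g,
  [/\ {within `[L, +oo[, continuous g}, f = g %[ae mu in half_line L] &
      g L = c].

Definition re_part u : R -> R := fun x => complex.Re (u x).
Definition im_part u : R -> R := fun x => complex.Im (u x).

Definition L2 L u := real_L2 L (re_part u) /\ real_L2 L (im_part u).

Definition weak_derivative L u v :=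
  real_weak_derivative L (re_part u) (re_part v) /\
  real_weak_derivative L (im_part u) (im_part v).

Definition boundary_value L u (c : R[i]) :=
  real_boundary_value L (re_part u) (complex.Re c) /\
  real_boundary_value L (im_part u) (complex.Im c).

Definition H2_derivatives L u v w :=
  [/\ L2 L u, L2 L v, L2 L w, weak_derivative L u v & weak_derivative L v w].

Definition H2 L u := exists v w, H2_derivatives L u v w.

End half_line.

Section star_graph.
Context {R : realType} {N : nat}.
Variable L : R.

Definition graph_fun := 'I_N -> R -> R[i].
Implicit Types (u v w : graph_fun).

Definition graph_L2 u := forall j, L2 L (u j).
Definition graph_H2 u := forall j, H2 L (u j).

Definition graph_eq u v :=
  forall j, u j = v j %[ae @lebesgue_measure R in half_line L].

Definition lincomb d (a : 'I_d -> R[i]) (e : 'I_d -> graph_fun) : graph_fun :=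
  fun j x => \sum_(k < d) a k * e k j x.

Definition has_dimension (V : set graph_fun) (d : nat) :=
  exists e : 'I_d -> graph_fun,
    [/\ forall k, V (e k),
        forall a, graph_eq (lincomb a e) (fun _ _ => 0) -> forall k, a k = 0 &
        forall u, V u -> exists a, graph_eq u (lincomb a e)].

(* Unbounded operators in L^2 of the graph are given by their graphs:
   T u v means that u is in the domain of T and T u = v. *)
Definition operator := graph_fun -> graph_fun -> Prop.
Implicit Types T : operator.

Definition restriction T (X : set graph_fun) : operator :=
  fun u v => X u /\ T u v.

Definition operator_eigenspace T (lambda : R) : set graph_fun :=
  [set u | T u (fun j x => lambda%:C * u j x)].

Definition operator_eigenvalue T (lambda : R) :=
  exists2 u, operator_eigenspace T lambda u & ~ graph_eq u (fun _ _ => 0).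

(* m = n(T); in particular the negative eigenvalues are finitely many. *)
Definition morse_index T (m : nat) :=
  exists (s : seq R) (mult : R -> nat),
    [/\ uniq s,
        forall lambda, lambda \in s <-> lambda < 0 /\ operator_eigenvalue T lambda,
        forall lambda, lambda \in s ->
          has_dimension (operator_eigenspace T lambda) (mult lambda) &
        m = (\sum_(lambda <- s) mult lambda)%N].

Definition X_mean (n : nat) : set graph_fun := [set u | graph_L2 u /\
  forall j k : 'I_N, (j < n)%N = (k < n)%N ->
    u j = u k %[ae @lebesgue_measure R in half_line L]].

Definition dom_delta' (Z : R) : set graph_fun := [set u | graph_H2 u /\
  exists (u' : graph_fun) (c : 'I_N -> R[i]) (d : R[i]),
    [/\ forall j, L2 L (u' j) /\ weak_derivative L (u j) (u' j),
        forall j, boundary_value L (u j) (c j),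
        forall j, boundary_value L (u' j) d &
        \sum_j c j = Z%:C * d]].

(* diag(- d^2/dx^2 + V_j) on the domain of the delta' vertex condition *)
Definition schroedinger_delta' (Z : R) (V : 'I_N -> R -> R) : operator :=
  fun u v => [/\ dom_delta' Z u, graph_L2 v &
    forall j, exists du ddu, H2_derivatives L (u j) du ddu /\
      v j = (fun x => - ddu x + (V j x)%:C * u j x)
        %[ae @lebesgue_measure R in half_line L]].

End star_graph.

Section profiles.
Context {R : realType}.

Definition cosh (x : R) := (expR x + expR (- x)) / 2.
Definition sech (x : R) := (cosh x)^-1.
Definition artanh (t : R) := ln ((1 + t) / (1 - t)) / 2.

Definition Psi (L omega a x : R) :=
  Num.sqrt (2 * omega) * sech (Num.sqrt omega * (x - L) + a).

Definition alpha (N n : nat) (t : R) :=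
  n%:R / t + (N - n)%:R / Num.sqrt (1 - t ^+ 2).

Definition t_star (N n : nat) : R :=
  Num.sqrt (n%:R `^ (2 / 3) / (n%:R `^ (2 / 3) + (N - n)%:R `^ (2 / 3))).

Definition omega_star (N n : nat) (Z : R) := alpha N n (t_star N n) ^+ 2 / Z ^+ 2.

Definition L_plus (N n : nat) (L Z omega t1 : R) : @operator R N :=
  let a1 := artanh t1 in
  let aN := artanh (Num.sqrt (1 - t1 ^+ 2)) in
  schroedinger_delta' L Z (fun j x =>
    omega - 3 * Psi L omega (if (j < n)%N then a1 else aN) x ^+ 2).

End profiles.

(* Main.v *)
(* Put lambda = omega (1 - kap^2) with kap > 1. On an edge the potential is a Poeschl-Teller
   well with l = 2, so that the decaying solution of the eigenvalue equation is explicit: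
   exp (- kap y) p(tanh y) with p(t) = kap^2 - 1 + 3 kap t + 3 t^2, and its derivative is
   exp (- kap y) q(tanh y) with q polynomial. A weak L^2 solution is a multiple of it: the
   Wronskian of the two has weak derivative 0, hence is constant, hence vanishes because it is
   integrable, and then so does the weak derivative of the quotient.

   The vertex condition thus becomes linear algebra on the coefficients c_j. If q(t1) and q(tN)
   are nonzero, the eigenspace is a line or 0 according to whether kap is a root of
   n p(t1)/q(t1) + (N - n) p(tN)/q(tN) - Z sqrt omega; if q vanishes on exactly one of the two
   sides, it consists of the coefficients with sum 0 supported on that side, and meets X_mean
   in 0. As p/q increases with kap between its poles, the roots are counted from the limit
   - Z sqrt omega > 0 at +oo and from the value at kap = 1, which is a positive multiple of
   - alpha'(t1) / (1 - 2 t1^2) with alpha'(t1) < 0. Finally 2 t1^2 < 1 is compared with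
   omega > 2 N^2 / Z^2 through alpha(t1)^2 = Z^2 omega. *)
Require Import Defs.
From mathcomp Require Import all_boot all_order all_algebra.
From mathcomp Require Import all_classical all_reals all_analysis.
From mathcomp Require Import measurable_realfun complex ring lra.
Set Implicit Arguments.
Unset Strict Implicit.
Unset Printing Implicit Defensive.
Import Order.TTheory GRing.Theory Num.Theory.
Import numFieldNormedType.Exports.
Local Open Scope classical_set_scope.
Local Open Scope ring_scope.
Local Open Scope complex_scope.

(** * Integration and weak derivatives on a half-line *)

Section half_line_analysis.
Context {R : realType}.
Notation mu := (@lebesgue_measure R).
Implicit Types (L : R) (f g h u v w phi : R -> R).

(** The three cases come from where [q] vanishes. Its value at [kap = 1] is 3 (1 + t) (1 - 2 t^2),
    and t1^2 + tN^2 = 1, so exactly one of the two sides has a zero beyond 1, unless t1 = tN, when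
    both zeros sit at 1. That zero contributes the number of edges of its side minus one, and
    nothing in X_mean; each root contributes one in either space. In (1) the zero is on the side of
    the n edges, with a root only to its right: (n - 1) + 1. In (2) it is on the other side, with
    one root on its left and one on its right: (N - n - 1) + 2. In (3) a single root is all there
    is.

    The domain is given by weak derivatives and almost everywhere equality, so no differential
    equation holds pointwise at the start; hence the product rule and the du Bois-Reymond lemma,
    with C^1 splines as bumps. For the roots, monotonicity in [kap] is an algebraic identity, and
    the intermediate value theorem is applied to polynomials cleared of denominators, so that no
    limit at a pole is taken. *)

Lemma integrable_sqr_Lfun2 f : measurable_fun setT f ->
  mu.-integrable setT (EFin \o (fun x => f x ^+ 2)) -> f \in Lfun mu 2%:E.
Proof.
move=> mf /integrableP[_ fi]; rewrite inE; apply/andP; split; rewrite inE//=.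
rewrite /finite_norm unlock poweR_lty//=.
apply: le_lt_trans fi; rewrite le_eqVlt; apply/orP; left; apply/eqP.
apply: eq_integral => x _ /=; rewrite powR_mulrn// normrX//.
Qed.

Lemma sqr_le_Lfun2 f g : measurable_fun setT f ->
  mu.-integrable setT (EFin \o g) -> (forall x, f x ^+ 2 <= g x) ->
  f \in Lfun mu 2%:E.
Proof.
move=> mf ig fg; apply: integrable_sqr_Lfun2 => //.
apply: (le_integrable measurableT _ _ ig) => [|x _].
  by apply/measurable_EFinP; exact: measurable_funX.
  rewrite lee_fin ger0_norm ?sqr_ge0//.
by rewrite (le_trans (fg x))// ler_norm.
Qed.

Lemma bounded_support_Lfun2 f (a b M : R) : measurable_fun setT f ->
  (forall x, `|f x| <= M) -> (forall x, f x != 0 -> a <= x <= b) ->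
  f \in Lfun mu 2%:E.
Proof.
move=> mf fM fs.
have i1 : mu.-integrable setT (EFin \o (\1_(`[a, b]%classic) : R -> R)).
  exact: integrable_indic_itv.
apply: (@sqr_le_Lfun2 _ (fun x => M ^+ 2 * \1_(`[a, b]%classic) x)) => //.
  by apply: (integrableZl measurableT (M^+2) i1).
move=> x; have [->|f0] := eqVneq (f x) 0.
  by rewrite expr0n/= mulr_ge0 ?sqr_ge0.
rewrite indicE mem_set ?mulr1 /= ?in_itv /= ?fs// -real_normK ?num_real//.
by rewrite lerXn2r ?nnegrE // (le_trans (normr_ge0 (f x)) (fM x)).
Qed.

Lemma restrict_half_lineM L f g :
  (fun x => f x * g x) \_ (half_line L) = (f \_ (half_line L)) \* g.
Proof. by apply/funext => x /=; rewrite !patchE; case: ifP; rewrite ?mul0r. Qed.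

Lemma measurable_half_line L : measurable (half_line L).
Proof. exact: measurable_itv. Qed.
#[local] Hint Resolve measurable_half_line : core.

End half_line_analysis.

(** * C^1 bump functions built from splines *)

Section bump.
Context {R : realType}.
Implicit Types (x y : R) (f g : R -> R).

Definition pospart x : R := Num.max 0 x.

Lemma pospart_pos x : 0 <= x -> pospart x = x.
Proof. by move=> x0; apply/max_idPr. Qed.

Lemma pospart_neg x : x <= 0 -> pospart x = 0.
Proof. by move=> x0; apply/max_idPl. Qed.

Lemma continuous_pospart : continuous pospart.
Proof.
move=> x; apply: (@continuous_max _ _ (cst 0) id); first exact: cvg_cst.
exact: cvg_id.
Qed.

Lemma is_derive_pospart_sqr x :
  is_derive x 1 (fun y => pospart y ^+ 2) (2 * pospart x).
Proof.
have [x0|x0|->] := ltgtP x 0.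
- rewrite pospart_neg ?ltW// mulr0.
  apply: (@near_eq_is_derive _ _ _ (cst 0)) => //.
  by near=> y; rewrite /= pospart_neg ?expr0n// ltW//; near: y; exact: lt_nbhsl.
- rewrite pospart_pos ?ltW//.
  apply: (@near_eq_is_derive _ _ _ (@id R ^+ 2)).
    by near=> y; rewrite /= pospart_pos ?ltW//; near: y; exact: lt_nbhsr.
  by apply: is_derive_eq; rewrite expr1 /GRing.scale /= mulr1.
(* At the junction the slope is explicit: the square of the positive part of [z], divided by [z], is
   the positive part again. *)
- apply/is_derive1_caratheodory; exists pospart; split.
  + move=> z; rewrite (pospart_neg (lexx _)) expr0n /= subr0 subr0 expr2.
    by have [z0|/ltW z0] := leP z 0; [rewrite pospart_neg// !mul0r|rewrite pospart_pos].
  + exact: continuous_pospart.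
  + by rewrite (pospart_neg (lexx _)) mulr0.
Unshelve. all: by end_near. Qed.

Lemma is_derive_pospart_cube x :
  is_derive x 1 (fun y => pospart y ^+ 3) (3 * pospart x ^+ 2).
Proof.
(* One factor is replaced by [id], which, unlike [pospart], is differentiable at 0; the products
   agree because both vanish on the negative side. *)
have -> : (fun y => pospart y ^+ 3) = id * (fun y => pospart y ^+ 2).
  apply/funext => y; rewrite /= !fctE exprS; have [y0|/ltW y0] := leP y 0.
    by rewrite pospart_neg// mul0r expr0n mulr0.
  by rewrite pospart_pos.
have ? := is_derive_pospart_sqr x.
apply: is_derive_eq; rewrite /GRing.scale /=.
have [y0|/ltW y0] := leP x 0.
  by rewrite pospart_neg// expr0n /=; ring.
by rewrite pospart_pos//; ring.
Qed.

(* The hat function for n = 1; spline n is a primitive of spline n.-1, as far as needed. *)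
Definition spline (n : nat) x : R :=
  (pospart (x + 1) ^+ n - 2 * pospart x ^+ n + pospart (x - 1) ^+ n) / (n`!)%:R.

Lemma is_derive_affine_comp f (a b x d : R) : is_derive (a * x + b) 1 f d ->
  is_derive x 1 (fun y => f (a * y + b)) (d * a).
Proof.
move=> fd; apply: (@is_derive1_comp _ f (fun y => a * y + b)).
have -> : (fun y => a * y + b) = (a \*: id) + cst b by [].
by apply: is_derive_eq; rewrite /= addr0 /GRing.scale /= mulr1.
Qed.

Lemma is_derive_spline (n : nat) x : (1 < n < 4)%N ->
  is_derive x 1 (spline n) (spline n.-1 x).
Proof.
move=> n24.
have D y : is_derive y 1 (fun y => pospart y ^+ n) (n%:R * pospart y ^+ n.-1).
  case: n n24 => [|[|[|[|n]]]]// _; [exact: is_derive_pospart_sqr|exact: is_derive_pospart_cube].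
have D1 := @is_derive_affine_comp _ 1 1 x _ (D _).
have D2 := D x.
have D3 := @is_derive_affine_comp _ 1 (-1) x _ (D _).
have -> : spline n = (n`!)%:R^-1 \*: ((fun y => pospart (1 * y + 1) ^+ n) - 2 \*: (fun y =>
  pospart y ^+ n) + (fun y => pospart (1 * y - 1) ^+ n)).
  by apply/funext => y; rewrite /spline /= !fctE !mul1r mulrC.
apply: is_derive_eq; rewrite /spline /GRing.scale /= !mul1r !mulr1.
case: n n24 {D D1 D2 D3} => [|[|[|[|n]]]]// _ /=; rewrite ?factS ?fact0 //=; by field.
Qed.

Lemma spline_le n x : (0 < n)%N -> x <= -1 -> spline n x = 0.
Proof.
move=> n0 x1; rewrite /spline !pospart_neg; [|lra..].
by rewrite expr0n; case: n n0 => //= n _; rewrite mulr0 subrr add0r mul0r.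
Qed.

(** To the right of the three nodes -1, 0, 1 no truncation is left, only a second difference of x^n
    / n!: the constant 1 for [n = 2], the identity for [n = 3]. *)
Lemma spline2_ge x : 1 <= x -> spline 2 x = 1.
Proof. by move=> x1; rewrite /spline !pospart_pos; [|lra..]; rewrite (_ : 2`!%:R = 2 :> R)//;
  field. Qed.

Lemma spline3_ge x : 1 <= x -> spline 3 x = x.
Proof. by move=> x1; rewrite /spline !pospart_pos; [|lra..]; rewrite (_ : 3`!%:R = 6 :> R)//;
  field. Qed.

Lemma spline2_01 x : 0 <= spline 2 x <= 1.
Proof.
have [x1|x1] := leP x (-1); first by rewrite spline_le// lexx ler01.
have [x2|x2] := leP 1 x; first by rewrite spline2_ge// lexx ler01.
rewrite /spline (pospart_pos (x := x + 1)) ?(pospart_neg (x := x - 1)); [|lra..].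
have -> : (2`!)%:R = 2 :> R by [].
have [x0|/ltW x0] := leP x 0; [rewrite pospart_neg//|rewrite pospart_pos//]; apply/andP;
  split; nra.
Qed.

Lemma continuous_spline n : continuous (spline n).
Proof.
have C : continuous (fun y => pospart y ^+ n).
  move=> y; apply: (@continuous_comp _ _ _ pospart (fun z => z ^+ n)).
    exact: continuous_pospart.
  exact: exprn_continuous.
have Ca a : continuous (fun y => pospart (y + a) ^+ n).
  move=> y; apply: (@continuous_comp _ _ _ (fun z => z + a) (fun z => pospart z ^+ n));
    last exact: C.
  by apply: cvgD; [exact: cvg_id|exact: cvg_cst].
move=> x; apply: cvgM; last exact: cvg_cst.
apply: cvgD; last exact: Ca.
apply: cvgB; first exact: Ca.
by apply: cvgM; [exact: cvg_cst|exact: C].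
Qed.

(** A difference of two smoothed unit steps, the first rising on [-1, 0], the second on [0, 1]. It
    is of class C^1, as test functions must be, and its elementary primitive climbs from 0 to 1, so
    that its mass is 1. *)
Definition bump x : R := spline 2 (2 * x + 1) - spline 2 (2 * x - 1).

Definition bump_primitive x : R := (spline 3 (2 * x + 1) - spline 3 (2 * x - 1)) / 2.

Lemma is_derive_bump_primitive x : is_derive x 1 bump_primitive (bump x).
Proof.
have D1 := @is_derive_affine_comp (spline 3) 2 1 x _ (@is_derive_spline 3 _ isT).
have D2 := @is_derive_affine_comp (spline 3) 2 (-1) x _ (@is_derive_spline 3 _ isT).
have -> : bump_primitive = 2^-1 \*: ((fun y => spline 3 (2 * y + 1)) - (fun y =>
  spline 3 (2 * y - 1))).
  by apply/funext => y; rewrite /bump_primitive /= !fctE mulrC.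
by apply: is_derive_eq; rewrite /bump /GRing.scale /=; field.
Qed.

Lemma is_derive_bump x :
  is_derive x 1 bump (2 * (spline 1 (2 * x + 1) - spline 1 (2 * x - 1))).
Proof.
have D1 := @is_derive_affine_comp (spline 2) 2 1 x _ (@is_derive_spline 2 _ isT).
have D2 := @is_derive_affine_comp (spline 2) 2 (-1) x _ (@is_derive_spline 2 _ isT).
have -> : bump = ((fun y => spline 2 (2 * y + 1)) - (fun y => spline 2 (2 * y - 1))) by [].
by apply: is_derive_eq; rewrite /=; ring.
Qed.

Lemma continuous_affine_comp f (a b : R) : continuous f -> continuous (fun y => f (a * y + b)).
Proof.
move=> cf y; apply: (@continuous_comp _ _ _ (fun z => a * z + b) f); last exact: cf.
apply: cvgD; last exact: cvg_cst.
by apply: cvgM; [exact: cvg_cst|exact: cvg_id].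
Qed.

Lemma continuous_bump : continuous bump.
Proof. by move=> x; apply: cvgB; apply: continuous_affine_comp; exact: continuous_spline. Qed.

Lemma continuous_bump' :
  continuous (fun x => 2 * (spline 1 (2 * x + 1) - spline 1 (2 * x - 1))).
Proof.
move=> x; apply: cvgM; first exact: cvg_cst.
by apply: cvgB; apply: continuous_affine_comp; exact: continuous_spline.
Qed.

Lemma bump_support x : bump x != 0 -> -1 < x < 1.
Proof.
apply: contraR; rewrite negb_and -!leNgt => /orP[x1|x1]; rewrite /bump.
  by rewrite !spline_le ?subrr//; lra.
by rewrite !spline2_ge ?subrr//; lra.
Qed.

Lemma bump_le1 x : `|bump x| <= 1.
Proof.
rewrite /bump ler_norml.
have := spline2_01 (2 * x + 1); have := spline2_01 (2 * x - 1); lra.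
Qed.

Lemma bump_primitive_le x : x <= -1 -> bump_primitive x = 0.
Proof. by move=> x1; rewrite /bump_primitive !spline_le ?subrr ?mul0r//; lra. Qed.

Lemma bump_primitive_ge x : 1 <= x -> bump_primitive x = 1.
Proof. by move=> x1; rewrite /bump_primitive !spline3_ge; [field|lra..]. Qed.

End bump.

(** * Averages against bumps at Lebesgue points *)

Section lebesgue_points.
Context {R : realType}.
Notation mu := (@lebesgue_measure R).
Implicit Types (L a b s e x : R) (f g h phi : R -> R).

Lemma is_derive_continuous f (x d : R) : is_derive x 1 f d -> {for x, continuous f}.
Proof. by move=> fd; apply/differentiable_continuous/derivable1_diffP; case: fd. Qed.

Lemma Rintegral_FTC2 f (F : R -> R) a b : a < b -> continuous f ->
  (forall x : R, is_derive x 1 F (f x)) ->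
  \int[mu]_(x in `[a, b]) f x = F b - F a.
Proof.
move=> ab cf Ff.
have cF x : {for x, continuous F} by exact: is_derive_continuous.
rewrite /Rintegral (@continuous_FTC2 _ _ F)// -?EFinB//.
- exact/continuous_subspaceT.
- split=> [x _||]; first by case: (Ff x).
    by apply: cvg_at_right_filter; exact: cF.
  by apply: cvg_at_left_filter; exact: cF.
- by move=> x _; rewrite derive1E; apply: derive_val.
Qed.

Lemma Rintegral_half_line_support L a b phi : L < a ->
  (forall x, phi x != 0 -> a <= x <= b) ->
  \int[mu]_(x in half_line L) phi x = \int[mu]_(x in `[a, b]) phi x.
Proof.
move=> La s; rewrite Rintegral_mkcond [RHS]Rintegral_mkcond; congr Rintegral.
apply/funext => x; rewrite !patchE; have [->|p0] := eqVneq (phi x) 0.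
  by rewrite !if_same.
have /andP[ax xb] := s _ p0.
rewrite !mem_set //= ?in_itv/= ?ax ?xb//.
by rewrite /half_line /= in_itv/= andbT (lt_le_trans La).
Qed.

Lemma locally_integrable_itv g a b : locally_integrable setT g ->
  mu.-integrable `[a, b] (EFin \o g).
Proof.
case=> mg _ ig; apply/integrableP; split.
  by apply/measurable_EFinP; exact: measurable_funS mg.
by apply: ig => //; exact: segment_compact.
Qed.

Lemma integrable_mul_bounded g h (a b M : R) : mu.-integrable `[a, b] (EFin \o g) ->
  measurable_fun setT h -> (forall x, `|h x| <= M) ->
  mu.-integrable `[a, b] (EFin \o (fun x => g x * h x)).
Proof.
move=> ig mh hM; have /integrableP[/measurable_EFinP mg _] := ig.
apply: (le_integrable _ _ _ (integrableZl _ M ig)) => //.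
  apply/measurable_EFinP; apply: measurable_funM => //.
  exact: measurable_funS mh.
move=> x _ /=; rewrite lee_fin !normrM mulrC.
by rewrite ler_wpM2r// (le_trans (hM x))// ler_norm.
Qed.

(** Height rather than mass is normalised: the bound 1 then holds for every [e], and the factor
    [e^-1] accompanies the integrals instead. *)
Definition scaled_bump s e x : R := bump ((x - s) / e).

Lemma scaled_bumpE s e x : scaled_bump s e x = bump (e^-1 * x + - (s / e)).
Proof. by rewrite /scaled_bump mulrBl mulrC. Qed.

Lemma continuous_scaled_bump s e : continuous (scaled_bump s e).
Proof.
rewrite (_ : scaled_bump s e = fun x => bump (e^-1 * x + - (s / e))).
  exact/continuous_affine_comp/continuous_bump.
by apply/funext => x; exact: scaled_bumpE.
Qed.

Lemma scaled_bump_support s e x : 0 < e -> scaled_bump s e x != 0 ->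
  s - e <= x <= s + e.
Proof.
move=> e0 /bump_support; rewrite ltr_pdivlMr// ltr_pdivrMr//; lra.
Qed.

Lemma Rintegral_scaled_bump s e : 0 < e ->
  e^-1 * \int[mu]_(x in `[s - e, s + e]) scaled_bump s e x = 1.
Proof.
move=> e0.
have D (x : R) : is_derive x 1 (fun x =>
  e * bump_primitive (e^-1 * x + - (s / e))) (scaled_bump s e x).
  rewrite scaled_bumpE.
  have D := @is_derive_affine_comp _ _ e^-1 (- (s / e)) x _ (is_derive_bump_primitive _).
  have -> : (fun x => e * bump_primitive (e^-1 * x + - (s / e))) = e \*: (fun x =>
    bump_primitive (e^-1 * x + - (s / e))) by [].
  by apply: is_derive_eq; rewrite /GRing.scale/= mulrC mulfVK ?gt_eqF.
rewrite (Rintegral_FTC2 _ _ D); [|by rewrite ltrD2l; lra|exact: continuous_scaled_bump].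
have e1 : e != 0 by rewrite gt_eqF.
rewrite -mulrBr mulrA mulVf// mul1r.
rewrite bump_primitive_ge ?bump_primitive_le ?subr0//.
  by rewrite [X in X <= _](_ : _ = -1)//; field.
by rewrite [X in _ <= X](_ : _ = 1)//; field.
Qed.

(** The bump is bounded by 1 on an interval of length 2 e, so the error is at most twice the mean of
    |g - g s| over the ball, which tends to 0 at a Lebesgue point. *)
Lemma bump_average g s (eps : R) : 0 < eps -> locally_integrable setT g ->
  lebesgue_pt g s ->
  \forall e \near 0^'+,
   `|e^-1 * \int[mu]_(x in `[s - e, s + e]) (g x * scaled_bump s e x) - g s| <= eps.
Proof.
move=> eps0 lg gs.
have : \forall y \near 0%E, (y < (eps / 2)%:E)%E.
  by apply: (@nbhs_open_ereal_lt R 0 (cst (eps / 2))); rewrite divr_gt0.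
move=> /gs near_davg; near=> e.
have e0 : 0 < e by [].
have : (davg g s e < (eps / 2)%:E)%E by near: e.
rewrite /davg /iavg (lebesgue_measure_ball _ (ltW e0)) inver mulrn_eq0/= gt_eqF//=.
set I := `[s - e, s + e]%classic.
have mI : measurable I by exact: measurable_itv.
have ig : mu.-integrable I (EFin \o g) by exact: locally_integrable_itv.
have ic : mu.-integrable I (EFin \o (cst (g s) : R -> R)).
  apply: continuous_compact_integrable; first exact: segment_compact.
  by apply: continuous_subspaceT => ?; exact: cvg_cst.
have id : mu.-integrable I (EFin \o (fun x => g x - g s)) by exact: (integrableB _ ig ic).
have mb : measurable_fun setT (scaled_bump s e).
  by apply: continuous_measurable_fun; exact: continuous_scaled_bump.
have ib f : mu.-integrable I (EFin \o f) ->
    mu.-integrable I (EFin \o (fun x => f x * scaled_bump s e x)).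
  move=> i; apply: (@integrable_mul_bounded _ _ _ _ 1) => // x; exact: bump_le1.
(* The mean is taken over the open ball, the bump integral over the closed interval; the endpoints
   are negligible. *)
have -> : (\int[mu]_(y in ball s e) `|(g y - g s)%:E| = (\int[mu]_(x in I) `|g x - g s|%R)%:E)%E.
  have ia : mu.-integrable I (EFin \o (fun x => `|g x - g s|)).
    exact: (integrable_norm id).
  rewrite ball_itv /Rintegral fineK; last exact: integrable_fin_num.
  have mf : measurable_fun I (fun x => `|g x - g s|).
    by case/integrableP: ia => /measurable_EFinP.
  rewrite -integral_itv_bndo_bndc; last first.
    by apply/measurable_EFinP; apply: measurable_funS mf => //; apply: subset_itvl;
      rewrite bnd_simp.
  rewrite -integral_itv_obnd_cbnd//.
  by apply/measurable_EFinP; apply: measurable_funS mf => //; apply: subset_itv;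
    rewrite bnd_simp.
rewrite -EFinM lte_fin => le2.
(* The value [g s] moves under the integral because the bump has mass [e]. *)
have -> : e^-1 * \int[mu]_(x in I) (g x * scaled_bump s e x) - g s =
    e^-1 * \int[mu]_(x in I) ((g x - g s) * scaled_bump s e x).
  have -> : \int[mu]_(x in I) ((g x - g s) * scaled_bump s e x) =
     \int[mu]_(x in I) (g x * scaled_bump s e x - g s * scaled_bump s e x).
    by apply: eq_Rintegral => x _; rewrite mulrBl.
  rewrite RintegralB// ?mulrBr; [|exact: ib|exact: (ib (cst (g s)))].
  congr (_ - _).
  have i1 : mu.-integrable I (EFin \o (scaled_bump s e)).
    apply: continuous_compact_integrable; first exact: segment_compact.
    by apply: continuous_subspaceT; exact: continuous_scaled_bump.
  by rewrite RintegralZl// mulrCA Rintegral_scaled_bump// mulr1.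
rewrite normrM gtr0_norm ?invr_gt0//.
have le1 : `|\int[mu]_(x in I)
  ((g x - g s) * scaled_bump s e x)| <= \int[mu]_(x in I) `|g x - g s|.
  apply: le_trans; first by apply: le_normr_Rintegral => //; exact: (ib _ id).
  apply: le_Rintegral => //.
  - exact: (integrable_norm (ib _ id)).
  - exact: (integrable_norm id).
  - by move=> x _ /=; rewrite normrM ler_piMr// bump_le1.
apply: (@le_trans _ _ (e^-1 * \int[mu]_(x in I) `|g x - g s|)).
  by rewrite ler_pM2l ?invr_gt0.
move: le2; set J := \int[mu]_(x in I) _; rewrite -mulr_natr invfM => le2.
apply: ltW; rewrite -(ltr_pM2l (x := 2^-1)) ?invr_gt0//; lra.
Unshelve. all: by end_near. Qed.

End lebesgue_points.

(** * Local integrability up to the endpoint of the half-line *)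

Section half_line_integrability.
Context {R : realType}.
Notation mu := (@lebesgue_measure R).
Implicit Types (L a b s e x : R) (f g h u m phi psi : R -> R).

Lemma continuous_bounded_itv m a b : continuous m ->
  exists M : R, forall x, a <= x <= b -> `|m x| <= M.
Proof.
move=> cm; have [ab|ba] := leP a b; last first.
  by exists 0 => x /andP[ax xb]; have := le_lt_trans (le_trans ax xb) ba; rewrite ltxx.
have [|c _ mc] := @EVT_max _ (fun x => `|m x|) a b ab.
  apply: continuous_subspaceT => x.
  by apply: (@continuous_comp _ _ _ m (fun z => `|z|)); [exact: cm|exact: norm_continuous].
by exists `|m c| => x xab; apply: mc; rewrite in_itv.
Qed.

Lemma continuous_bounded_support m a b : continuous m ->
  (forall x, m x != 0 -> a <= x <= b) -> exists M : R, forall x, `|m x| <= M.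
Proof.
move=> cm ms; have [M mM] := continuous_bounded_itv a b cm.
exists (Num.max M 0) => x; have [->|/ms/mM] := eqVneq (m x) 0.
  by rewrite normr0 le_max lexx orbT.
by rewrite le_max => ->.
Qed.

Lemma locally_integrable_setT g : measurable_fun setT g ->
  (forall a b, mu.-integrable `[a, b] (EFin \o g)) -> locally_integrable setT g.
Proof.
move=> mg ig; split => //; first exact: openT.
move=> K _ cK; have [M [_ KM]] := compact_bounded cK.
have mK : measurable K by exact: compact_measurable.
have /integrableP[_ iK] := ig (- (M + 1)) (M + 1).
apply: le_lt_trans iK; apply: ge0_subset_integral => //.
  by do 2 apply: measurableT_comp => //; exact: measurable_funS mg.
by move=> x Kx; rewrite /= in_itv/= -ler_norml; apply: (KM (M + 1)) => //; rewrite ltrDl.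
Qed.

(** Extension by 0 to the whole line makes Lebesgue differentiation available. Integrability is
    thereby asked up to the endpoint [L], which is more than local integrability on the open
    half-line. *)
Definition half_line_loc_L1 L f := locally_integrable setT (f \_ (half_line L)).

(** The Hoelder inequality against the indicator function of a compact interval. *)
Lemma half_line_loc_L1_L2 L u : real_L2 L u -> half_line_loc_L1 L u.
Proof.
move=> uL; have mu' : measurable_fun setT (u \_ (half_line L)).
  by move: uL; rewrite /real_L2 inE => /andP[/[!inE]].
apply: locally_integrable_setT => // a b.
have iL : (\1_(`[a, b]%classic) : R -> R) \in Lfun mu 2%:E.
  apply: (@bounded_support_Lfun2 _ _ a b 1).
  - exact: measurable_indic.
  - by move=> x; rewrite indicE; case: (_ \in _); rewrite ?normr0 ?normr1.
  - move=> x; rewrite indicE; case: (boolP (x \in _)); last by rewrite eqxx.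
    by rewrite inE /= in_itv.
have /Lfun1_integrable := Lfun2_mul_Lfun1 uL iL.
rewrite (_ : _ \* _ = (u \_ (half_line L)) \_ `[a, b]).
  by rewrite -restrict_EFin => i; apply/integrable_mkcond => //; exact: measurable_itv.
apply/funext => x /=; rewrite indicE [RHS]patchE; case: (boolP (x \in `[a, b]%classic)) => _.
  by rewrite mulr1.
by rewrite mulr0.
Qed.

Lemma half_line_loc_L1M L u m : continuous m -> half_line_loc_L1 L u ->
  half_line_loc_L1 L (fun x => u x * m x).
Proof.
move=> cm lu; have [mu' _ _] := lu.
have mm : measurable_fun setT m by exact: continuous_measurable_fun.
rewrite /half_line_loc_L1 restrict_half_lineM.
apply: locally_integrable_setT; first exact: measurable_funM.
move=> a b; have [M mM] := continuous_bounded_itv a b cm.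
apply: (le_integrable _ _ _ (integrableZl _ M (locally_integrable_itv a b lu))) => //.
  apply/measurable_EFinP; apply: measurable_funM => //;
    exact: measurable_funS mu' || exact: measurable_funS mm.
move=> x /=; rewrite in_itv/= => xab; rewrite lee_fin !normrM mulrC.
by rewrite ler_wpM2r// (le_trans (mM _ xab))// ler_norm.
Qed.

Lemma half_line_loc_L1B L f g : half_line_loc_L1 L f -> half_line_loc_L1 L g ->
  half_line_loc_L1 L (fun x => f x - g x).
Proof.
move=> lf lg; rewrite /half_line_loc_L1 (_ : _ \_ _ =
  f \_ (half_line L) \- g \_ (half_line L))%R.
  exact: locally_integrableB.
by apply/funext => x /=; rewrite !patchE; case: ifP; rewrite ?subrr.
Qed.

Lemma half_line_loc_L1D L f g : half_line_loc_L1 L f -> half_line_loc_L1 L g ->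
  half_line_loc_L1 L (fun x => f x + g x).
Proof.
move=> lf lg; rewrite /half_line_loc_L1 (_ : _ \_ _ =
  f \_ (half_line L) \+ g \_ (half_line L))%R.
  exact: locally_integrableD.
by apply/funext => x /=; rewrite !patchE; case: ifP; rewrite ?addr0.
Qed.

Lemma integrable_half_line_support L a b phi : L < a ->
  (forall x, phi x != 0 -> a <= x <= b) ->
  mu.-integrable `[a, b] (EFin \o phi) -> mu.-integrable (half_line L) (EFin \o phi).
Proof.
move=> La s i; apply/integrable_mkcond; first exact: measurable_half_line.
move: i => /integrable_mkcond => /(_ (measurable_itv _)).
rewrite !restrict_EFin (_ : phi \_ `[a, b] = phi \_ (half_line L))//.
apply/funext => x; rewrite !patchE; have [->|p0] := eqVneq (phi x) 0.
  by rewrite !if_same.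
have /andP[ax xb] := s _ p0.
rewrite !mem_set //= ?in_itv/= ?ax ?xb//.
by rewrite /half_line /= in_itv/= andbT (lt_le_trans La).
Qed.

Lemma half_line_restrict L a f x : L < a -> a <= x -> (f \_ (half_line L)) x = f x.
Proof.
move=> La ax; rewrite patchE mem_set//.
by rewrite /half_line /= in_itv/= andbT (lt_le_trans La).
Qed.

Lemma half_line_pairing_integrable L f psi a b : half_line_loc_L1 L f ->
  continuous psi -> L < a -> (forall x, psi x != 0 -> a <= x <= b) ->
  mu.-integrable (half_line L) (EFin \o (fun x => f x * psi x)).
Proof.
move=> lf cp La s; apply: (integrable_half_line_support La (b := b)).
  by move=> x; rewrite mulf_eq0 negb_or => /andP[_ /s].
have [M pM] := continuous_bounded_support cp s.
have := integrable_mul_bounded (locally_integrable_itv a b lf) (continuous_measurable_fun cp) pM.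
apply: eq_integrable; first exact: measurable_itv.
move=> x; rewrite inE /= in_itv/= => /andP[ax xb].
by rewrite /= (half_line_restrict _ La).
Qed.

End half_line_integrability.

(** * Test functions *)

Section test_functions.
Context {R : realType}.
Notation mu := (@lebesgue_measure R).
Implicit Types (L a b s e x : R) (f g h u m phi psi : R -> R).

Lemma test_function_is_derive L phi x : test_function L phi ->
  is_derive x 1 phi (derive1 phi x).
Proof. by case=> d _ _; rewrite derive1E; apply: DeriveDef. Qed.

Lemma is_derive_derive1 f g : (forall x : R, is_derive x 1 f (g x)) -> derive1 f = g.
Proof. by move=> fg; apply/funext => x; rewrite derive1E; apply: derive_val. Qed.

Lemma is_derive_test_function L phi psi a b :
  (forall x : R, is_derive x 1 phi (psi x)) -> continuous psi -> L < a ->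
  (forall x, phi x != 0 -> a <= x <= b) -> test_function L phi.
Proof.
move=> D cp La s; split; last by exists a, b.
  by move=> x; case: (D x).
by rewrite (is_derive_derive1 D).
Qed.

(** Off the closed interval the function vanishes on a whole neighbourhood, so its derivative
    vanishes there too. *)
Lemma test_function_support L phi : test_function L phi -> exists a b,
  [/\ L < a, forall x, phi x != 0 -> a <= x <= b &
   forall x, derive1 phi x != 0 -> a <= x <= b].
Proof.
move=> [_ _ [a [b [La s]]]]; exists a, b; split => // x; apply: contraR.
rewrite negb_and -!ltNge => xab; apply/eqP.
rewrite derive1E; apply: derive_val; apply: (@near_eq_is_derive _ _ _ (cst 0)) => //.
case/orP: xab => [xa|bx]; near=> y; apply/esym/eqP; apply: contraT => /s /andP[].
  by rewrite leNgt; have -> : y < a by near: y; exact: lt_nbhsl.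
by move=> _; rewrite leNgt; have -> : b < y by near: y; exact: lt_nbhsr.
Unshelve. all: by end_near. Qed.

Lemma test_function_continuous L phi : test_function L phi -> continuous phi.
Proof. by move=> t x; apply: is_derive_continuous (test_function_is_derive x t). Qed.

(** Differentiability of [m] is asked only beyond [L], since the test function is locally zero at
    [L] and to its left. This admits multipliers with a corner at [L]. *)
Lemma test_functionM L phi m m' : test_function L phi ->
  continuous m -> continuous m' -> (forall x, L < x -> is_derive x 1 m (m' x)) ->
  test_function L (fun x => phi x * m x) /\
  derive1 (fun x => phi x * m x) = (fun x => derive1 phi x * m x + phi x * m' x).
Proof.
move=> tp cm cm' D; have [a [b [La s s']]] := test_function_support tp.
have Dp x : is_derive x 1 (fun x => phi x * m x) (derive1 phi x * m x + phi x * m' x).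
  have [Lx|xL] := ltP L x.
    have := D _ Lx; have := test_function_is_derive x tp => ? ?.
    apply: (@is_derive_eq _ _ _ (phi * m)).
    by rewrite /GRing.scale /= addrC mulrC.
  have xa : x < a by exact: le_lt_trans La.
  have -> : phi x = 0 by apply/eqP; apply: contraT => /s; rewrite (leNgt a) xa.
  have -> : derive1 phi x = 0 by apply/eqP; apply: contraT => /s'; rewrite (leNgt a) xa.
  rewrite !mul0r addr0.
  apply: (@near_eq_is_derive _ _ _ (cst 0)) => //.
  near=> y; have -> : phi y = 0; last by rewrite mul0r.
  apply/eqP; apply: contraT => /s /andP[].
  by rewrite leNgt; have -> : y < a by near: y; exact: lt_nbhsl.
split; last exact: is_derive_derive1.
apply: (is_derive_test_function Dp _ La (b := b)).
  move=> x; apply: cvgD; apply: cvgM; [by case: tp => _ cp _; exact: cp|exact: cm| |exact: cm'].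
  exact: test_function_continuous tp _.
by move=> x; rewrite mulf_eq0 negb_or => /andP[/s].
Unshelve. all: by end_near. Qed.

Lemma is_derive_scaled_bump s e (x : R) :
  is_derive x 1 (scaled_bump s e)
   (2 * (spline 1 (2 * (e^-1 * x + - (s / e)) + 1) - spline 1 (2 * (e^-1 * x + -
     (s / e)) - 1)) * e^-1).
Proof.
rewrite (_ : scaled_bump s e = fun x => bump (e^-1 * x + - (s / e))).
  exact: is_derive_affine_comp (is_derive_bump _).
by apply/funext => y; exact: scaled_bumpE.
Qed.

Lemma test_function_scaled_bump L s e : 0 < e -> L < s - e ->
  test_function L (scaled_bump s e).
Proof.
move=> e0 Ls; apply: (is_derive_test_function (is_derive_scaled_bump s e) _ Ls (b := s + e)).
  move=> x; apply: cvgM; last exact: cvg_cst.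
  apply: (@continuous_affine_comp _ (fun z =>
    2 * (spline 1 (2 * z + 1) - spline 1 (2 * z - 1)))).
  exact: continuous_bump'.
by move=> x; exact: scaled_bump_support.
Qed.

End test_functions.

(** * Calculus of weak derivatives and uniqueness of decaying solutions *)

Section weak_derivatives.
Context {R : realType}.
Notation mu := (@lebesgue_measure R).
Implicit Types (L a b s e x : R) (f g h u v w m phi psi : R -> R).

Lemma aeS (P Q : R -> Prop) : (forall x, P x -> Q x) ->
  (\forall x \ae mu, P x) -> \forall x \ae mu, Q x.
Proof. exact: (@filterS _ _ (ae_filter_ringOfSetsType mu)). Qed.

Lemma aeS2 (P P' Q : R -> Prop) : (forall x, P x -> P' x -> Q x) ->
  (\forall x \ae mu, P x) -> (\forall x \ae mu, P' x) -> \forall x \ae mu, Q x.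
Proof.
move=> PQ aP aP'; have := @filterI _ _ (ae_filter_ringOfSetsType mu) _ _ aP aP'.
by apply: aeS => x [Px]; exact: PQ.
Qed.

Lemma lebesgue_measure_half_line L : mu (half_line L) = +oo%E.
Proof. by rewrite /half_line lebesgue_measure_itv /= ltry. Qed.

Lemma ae_half_line_ex L (P : R -> Prop) :
  (\forall x \ae mu, half_line L x -> P x) -> exists2 x, half_line L x & P x.
Proof.
move=> [A [mA A0 PA]]; apply: contrapT => nP.
have DA : half_line L `<=` A.
  by move=> x Dx; apply: PA => /= DP; apply: nP; exists x => //; exact: DP.
have : (mu (half_line L) <= mu A)%E.
  by apply: le_measure => //; rewrite inE; [exact: measurable_half_line|exact: mA].
by rewrite A0 lebesgue_measure_half_line.
Qed.

Lemma half_line_bump_average L h s (eps : R) : 0 < eps -> L < s ->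
  half_line_loc_L1 L h -> lebesgue_pt (h \_ (half_line L)) s ->
  \forall e \near 0^'+, test_function L (scaled_bump s e) /\
   `|e^-1 * \int[mu]_(x in half_line L) (h x * scaled_bump s e x) - h s| <= eps.
Proof.
move=> eps0 Ls lh hs; have := bump_average eps0 lh hs.
rewrite (half_line_restrict _ (a := s) Ls)// => N.
near=> e; have e0 : 0 < e by [].
have Lse : L < s - e.
  by rewrite ltrBrDl -ltrBrDr; near: e; apply: nbhs_right_lt; rewrite subr_gt0.
split; first exact: test_function_scaled_bump.
rewrite (Rintegral_half_line_support Lse (b := s + e)); last first.
  by move=> x; rewrite mulf_eq0 negb_or => /andP[_]; exact: scaled_bump_support.
rewrite (@eq_Rintegral _ _ _ mu _ (fun x => (h \_ (half_line L)) x * scaled_bump s e x)).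
  by near: e.
by move=> x; rewrite inE /= in_itv/= => /andP[ax _]; rewrite (half_line_restrict _ Lse).
Unshelve. all: by end_near. Qed.

Lemma ae_half_line_lebesgue_pt L h : half_line_loc_L1 L h ->
  \forall x \ae mu, lebesgue_pt (h \_ (half_line L)) x.
Proof. exact: lebesgue_differentiation. Qed.

(** Against bumps shrinking to a Lebesgue point, the vanishing pairings converge to the value of [h]
    there. *)
Lemma weak_zero L h : half_line_loc_L1 L h ->
  (forall phi, test_function L phi -> \int[mu]_(x in half_line L) (h x * phi x) = 0) ->
  h = cst 0 %[ae mu in half_line L].
Proof.
move=> lh h0; apply: aeS (ae_half_line_lebesgue_pt lh) => s hs.
rewrite /half_line /= in_itv/= andbT => Ls.
apply/eqP; rewrite -normr_le0; apply/ler_addgt0Pl => eps eps0; rewrite addr0.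
have N := half_line_bump_average eps0 Ls lh hs.
near (0 : R)^'+ => e.
have [te] : test_function L (scaled_bump s e) /\
   `|e^-1 * \int[mu]_(x in half_line L) (h x * scaled_bump s e x) - h s| <= eps by near: e.
by rewrite h0// mulr0 sub0r normrN.
Unshelve. all: by end_near. Qed.

(** Both bumps have the same mass, so the primitive of their difference returns to 0 on the far
    right and has compact support. *)
Lemma scaled_bump_difference_primitive L s s' e : 0 < e -> L < s - e -> L < s' - e ->
  exists2 phi, test_function L phi &
    derive1 phi = fun x => e^-1 * (scaled_bump s e x - scaled_bump s' e x).
Proof.
move=> e0 Ls Ls'.
pose P (c x : R) : R := bump_primitive (e^-1 * x + - (c / e)).
have DP (c x : R) : is_derive x 1 (P c) (scaled_bump c e x * e^-1).
  rewrite scaled_bumpE.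
  exact: is_derive_affine_comp (is_derive_bump_primitive _).
have D (x : R) : is_derive x 1 (P s - P s') (e^-1 * (scaled_bump s e x - scaled_bump s' e x)).
  have := DP s x; have := DP s' x => ? ?.
  apply: is_derive_eq; rewrite mulrC; ring.
exists (P s - P s'); last exact: is_derive_derive1.
have PE c x : P c x = bump_primitive ((x - c) / e).
  by rewrite /P mulrBl mulrC.
have Lm : L < Num.min s s' - e by rewrite ltrBrDr lt_min -!ltrBrDr Ls Ls'.
apply: (is_derive_test_function D _ Lm (b := Num.max s s' + e)).
  move=> x; apply: cvgM; first exact: cvg_cst.
  by apply: cvgB; exact: continuous_scaled_bump.
move=> x; apply: contraR; rewrite negb_and -!ltNge !fctE !PE.
case/orP => [xm|mx].
  rewrite !bump_primitive_le ?subrr//.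
    rewrite ler_pdivrMr// mulN1r lerBlDr; apply: le_trans (ltW xm) _.
    by rewrite addrC lerD2l ge_min lexx orbT.
  rewrite ler_pdivrMr// mulN1r lerBlDr; apply: le_trans (ltW xm) _.
  by rewrite addrC lerD2l ge_min lexx.
rewrite !bump_primitive_ge ?subrr//.
  rewrite ler_pdivlMr// mul1r lerBrDr; apply: le_trans (ltW mx).
  by rewrite addrC lerD2r le_max lexx orbT.
rewrite ler_pdivlMr// mul1r lerBrDr; apply: le_trans (ltW mx).
by rewrite addrC lerD2r le_max lexx.
Qed.

(* Du Bois-Reymond: the pairings of h with bumps of equal mass around two
   Lebesgue points agree, and converge to the values of h there. *)
Lemma weak_derivative0_cst L h : half_line_loc_L1 L h ->
  real_weak_derivative L h (cst 0) ->
  exists c : R, h = cst c %[ae mu in half_line L].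
Proof.
move=> lh h0; have al := ae_half_line_lebesgue_pt lh.
have [s0] : exists2 s0, half_line L s0 & lebesgue_pt (h \_ (half_line L)) s0.
  by apply: ae_half_line_ex; apply: aeS al.
rewrite /half_line /= in_itv/= andbT => Ls0 hs0.
exists (h s0); apply: aeS al => s hs.
rewrite /half_line /= in_itv/= andbT => Ls.
apply/eqP; rewrite -subr_eq0 -normr_le0; apply/ler_addgt0Pl => eps eps0; rewrite addr0.
have eps2 : 0 < eps / 2 by rewrite divr_gt0.
suff [e [A B]] : exists e : R, e^-1 * \int[mu]_(x in half_line L) (h x * scaled_bump s e x) =
     e^-1 * \int[mu]_(x in half_line L) (h x * scaled_bump s0 e x) /\
     (`|e^-1 * \int[mu]_(x in half_line L) (h x * scaled_bump s e x) - h s| <= eps / 2 /\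
     `|e^-1 * \int[mu]_(x in half_line L) (h x * scaled_bump s0 e x) - h s0| <= eps / 2).
  move: B; rewrite A !ler_norml; lra.
have N1 := half_line_bump_average eps2 Ls lh hs.
have N2 := half_line_bump_average eps2 Ls0 lh hs0.
near (0 : R)^'+ => e; exists e.
have e0 : 0 < e by [].
have Lse : L < s - e.
  by rewrite ltrBrDl -ltrBrDr; near: e; apply: nbhs_right_lt; rewrite subr_gt0.
have Lse0 : L < s0 - e.
  by rewrite ltrBrDl -ltrBrDr; near: e; apply: nbhs_right_lt; rewrite subr_gt0.
split; last first.
  split.
    by suff [] : test_function L (scaled_bump s e) /\ `|e^-1 * \int[mu]_(x in half_line L)
      (h x * scaled_bump s e x) - h s| <= eps / 2 by []; near: e.
  by suff [] : test_function L (scaled_bump s0 e) /\ `|e^-1 * \int[mu]_(x in half_line L)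
    (h x * scaled_bump s0 e x) - h s0| <= eps / 2 by []; near: e.
have [phi tphi dphi] := scaled_bump_difference_primitive e0 Lse Lse0.
have := h0 _ tphi; rewrite dphi.
have ib c : L < c - e -> mu.-integrable (half_line L) (EFin \o (fun x =>
  h x * scaled_bump c e x)).
  move=> Lc.
  exact: (half_line_pairing_integrable lh (@continuous_scaled_bump _ c e) Lc (fun x =>
    @scaled_bump_support _ c e x e0)).
under eq_Rintegral do rewrite mulrCA mulrBr.
rewrite RintegralZl; [|exact: measurable_half_line|]; last first.
  by apply: (integrableB _ (ib _ Lse) (ib _ Lse0)); exact: measurable_half_line.
rewrite RintegralB; [|exact: measurable_half_line|exact: ib|exact: ib].
under [in RHS]eq_Rintegral do rewrite mul0r.
rewrite Rintegral_cst; last exact: measurable_half_line.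
by rewrite mul0r oppr0 mulrBr => /eqP; rewrite subr_eq0 => /eqP.
Unshelve. all: by end_near. Qed.

Lemma real_weak_derivative_unique L u v w : real_L2 L v -> real_L2 L w ->
  real_weak_derivative L u v -> real_weak_derivative L u w ->
  v = w %[ae mu in half_line L].
Proof.
move=> v2 w2 uv uw.
have lv := half_line_loc_L1_L2 v2; have lw := half_line_loc_L1_L2 w2.
suff : (fun x => v x - w x) = cst 0 %[ae mu in half_line L].
  by apply: aeS => x /[apply]/= /eqP; rewrite subr_eq0 => /eqP.
apply: weak_zero; first exact: half_line_loc_L1B.
move=> phi tphi; have [a [b [La s _]]] := test_function_support tphi.
have cp := test_function_continuous tphi.
under eq_Rintegral do rewrite mulrBl.
rewrite RintegralB; [|exact: measurable_half_line|exact: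
  (half_line_pairing_integrable lv cp La s)|exact: (half_line_pairing_integrable lw cp La s)].
have := uw _ tphi; rewrite uv// => /oppr_inj ->; exact: subrr.
Qed.

(** The product rule is the definition of the weak derivative of [u] with [phi * m] as test
    function. *)
Lemma real_weak_derivativeM L u v m m' : half_line_loc_L1 L u -> half_line_loc_L1 L v ->
  real_weak_derivative L u v -> continuous m -> continuous m' ->
  (forall x, L < x -> is_derive x 1 m (m' x)) ->
  real_weak_derivative L (fun x => u x * m x) (fun x => v x * m x + u x * m' x).
Proof.
move=> lu lv uv cm cm' D phi tphi.
have [a [b [La s s']]] := test_function_support tphi.
have cp := test_function_continuous tphi.
have cp' : continuous (derive1 phi) by case: tphi.
have [tpm dpm] := test_functionM tphi cm cm' D.
have i1 : mu.-integrable (half_line L) (EFin \o (fun x => u x * m x * derive1 phi x)).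
  exact: (half_line_pairing_integrable (half_line_loc_L1M cm lu) cp' La s').
have i2 : mu.-integrable (half_line L) (EFin \o (fun x => u x * m' x * phi x)).
  exact: (half_line_pairing_integrable (half_line_loc_L1M cm' lu) cp La s).
have i3 : mu.-integrable (half_line L) (EFin \o (fun x => v x * m x * phi x)).
  exact: (half_line_pairing_integrable (half_line_loc_L1M cm lv) cp La s).
have mD := @measurable_half_line R L.
have E1 : \int[mu]_(x in half_line L) (u x * (derive1 phi x * m x + phi x * m' x)) =
    \int[mu]_(x in half_line L) (u x * m x * derive1 phi x) + \int[mu]_(x in half_line L)
      (u x * m' x * phi x).
  rewrite -RintegralD//; apply: eq_Rintegral => x _; ring.
have E2 : \int[mu]_(x in half_line L) ((v x * m x + u x * m' x) * phi x) =
    \int[mu]_(x in half_line L) (v x * m x * phi x) + \int[mu]_(x in half_line L)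
      (u x * m' x * phi x).
  rewrite -RintegralD//; apply: eq_Rintegral => x _; ring.
have E3 : \int[mu]_(x in half_line L) (v x * (phi x * m x)) =
  \int[mu]_(x in half_line L) (v x * m x * phi x).
  apply: eq_Rintegral => x _; ring.
have := uv _ tpm; rewrite dpm E1 E2 E3; lra.
Qed.

Lemma real_weak_derivativeB L u u' v v' : half_line_loc_L1 L u -> half_line_loc_L1 L u' ->
  half_line_loc_L1 L v -> half_line_loc_L1 L v' ->
  real_weak_derivative L u u' -> real_weak_derivative L v v' ->
  real_weak_derivative L (fun x => u x - v x) (fun x => u' x - v' x).
Proof.
move=> lu lu' lv lv' du dv phi tphi.
have [a [b [La s s']]] := test_function_support tphi.
have cp := test_function_continuous tphi.
have cp' : continuous (derive1 phi) by case: tphi.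
have mD := @measurable_half_line R L.
under eq_Rintegral do rewrite mulrBl.
under [in RHS]eq_Rintegral do rewrite mulrBl.
rewrite !RintegralB//; try exact: (half_line_pairing_integrable _ cp La s);
  try exact: (half_line_pairing_integrable _ cp' La s').
rewrite du// dv//; lra.
Qed.

Lemma real_weak_derivative_ae0 L u v : half_line_loc_L1 L v ->
  v = cst 0 %[ae mu in half_line L] ->
  real_weak_derivative L u v -> real_weak_derivative L u (cst 0).
Proof.
move=> lv v0 uv phi tphi; rewrite uv//; congr (- _).
have [a [b [La s s']]] := test_function_support tphi.
have cp := test_function_continuous tphi.
have mD := @measurable_half_line R L.
congr fine; apply: ae_eq_integral => //.
- by have /integrableP[] := half_line_pairing_integrable lv cp La s.
- by under eq_fun do rewrite mul0r; exact: measurable_cst.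
- by apply: aeS v0 => x vx Dx; rewrite vx.
Qed.

Lemma real_L2M_integrable L u v : real_L2 L u -> real_L2 L v ->
  mu.-integrable (half_line L) (EFin \o (fun x => u x * v x)).
Proof.
move=> uL vL; have /Lfun1_integrable := Lfun2_mul_Lfun1 uL vL.
rewrite (_ : _ \* _ = (fun x => u x * v x) \_ (half_line L)).
  move=> i; apply/integrable_mkcond; first exact: measurable_half_line.
  by rewrite restrict_EFin.
by apply/funext => x /=; rewrite !patchE; case: ifP; rewrite ?mul0r.
Qed.

Lemma integrable_cst_half_line L h (c : R) :
  mu.-integrable (half_line L) (EFin \o h) -> h = cst c %[ae mu in half_line L] -> c = 0.
Proof.
move=> /integrableP[mh ih] hc; apply/eqP; rewrite -normr_le0 leNgt; apply/negP => c0.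
have mD := @measurable_half_line R L.
have : (\int[mu]_(x in half_line L) `|(EFin \o h) x| =
  \int[mu]_(x in half_line L) (cst `|c|%:E) x)%E.
  apply: ae_eq_integral => //; first exact: measurableT_comp.
  by apply: aeS hc => x hx Dx; rewrite /= hx.
rewrite integral_cst// => E; move: ih; rewrite E => ih.
have H : (`|c|%:E * mu (half_line L) = +oo)%E.
  by rewrite lebesgue_measure_half_line mulry gtr0_sg// mul1e.
by move: (eq_ind _ (fun z => is_true (z < +oo)%E) ih _ H); rewrite ltxx.
Qed.

(** The relation [w * F = u * F2] says that [u] and [F] solve the same equation f'' = V f without
    naming V. Square integrability of [F] and [F1] makes the Wronskian integrable. *)
Lemma decaying_solution_unique L u v w (F F1 F2 : R -> R) :
  (forall x : R, is_derive x 1 F (F1 x)) -> (forall x : R, is_derive x 1 F1 (F2 x)) ->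
  continuous F2 -> (forall x, L <= x -> 0 < F x) ->
  real_L2 L F -> real_L2 L F1 ->
  real_L2 L u -> real_L2 L v -> real_L2 L w ->
  real_weak_derivative L u v -> real_weak_derivative L v w ->
  (fun x => w x * F x) = (fun x => u x * F2 x) %[ae mu in half_line L] ->
  exists c : R, u = (fun x => c * F x) %[ae mu in half_line L] /\
    v = (fun x => c * F1 x) %[ae mu in half_line L].
Proof.
move=> DF DF1 cF2 F0 F2L F12 u2 v2 w2 uv vw wF.
have cF : continuous F by move=> x; exact: is_derive_continuous (DF x).
have cF1 : continuous F1 by move=> x; exact: is_derive_continuous (DF1 x).
have lu := half_line_loc_L1_L2 u2; have lv := half_line_loc_L1_L2 v2.
have lw := half_line_loc_L1_L2 w2.
have D1 := real_weak_derivativeM lu lv uv cF1 cF2 (fun x _ => DF1 x).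
have D2 := real_weak_derivativeM lv lw vw cF cF1 (fun x _ => DF x).
have l1 : half_line_loc_L1 L (fun x => u x * F1 x) by exact: half_line_loc_L1M.
have l2 : half_line_loc_L1 L (fun x => v x * F x) by exact: half_line_loc_L1M.
have l3 : half_line_loc_L1 L (fun x => v x * F1 x + u x * F2 x).
  by apply: half_line_loc_L1D; exact: half_line_loc_L1M.
have l4 : half_line_loc_L1 L (fun x => w x * F x + v x * F1 x).
  by apply: half_line_loc_L1D; exact: half_line_loc_L1M.
have D := real_weak_derivativeB l1 l3 l2 l4 D1 D2.
have [|c Wc] := weak_derivative0_cst (half_line_loc_L1B l1 l2) (real_weak_derivative_ae0
  (half_line_loc_L1B l3 l4) _ D).
  by apply: aeS wF => x wx Dx /=; rewrite wx//; ring.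
have c0 : c = 0.
  apply: (integrable_cst_half_line _ Wc).
  by apply: (integrableB _ (real_L2M_integrable u2 F12) (real_L2M_integrable v2 F2L));
    exact: measurable_half_line.
have uFvF : (fun x => u x * F1 x) = (fun x => v x * F x) %[ae mu in half_line L].
  apply: aeS Wc => x Wx Dx; apply/eqP; rewrite -subr_eq0; apply/eqP.
  by rewrite Wx.
(* [F] is known to be positive on [L, +oo[ only. Freezing its reciprocal at the value at [L] further
   left yields a multiplier continuous on the whole line, with a possible corner at [L]. *)
have cmax : continuous (fun x => Num.max L x).
  move=> x; apply: (@continuous_max _ _ (cst L) id); [exact: cvg_cst|exact: cvg_id].
have Fmax x : F (Num.max L x) != 0 by rewrite gt_eqF// F0// le_max lexx.
pose m x := (F (Num.max L x))^-1.
pose m' x := - F1 (Num.max L x) * (F (Num.max L x))^-1 ^+ 2.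
have cm : continuous m.
  move=> x; apply: cvgV; first exact: Fmax.
  by apply: (@continuous_comp _ _ _ (fun x => Num.max L x) F); [exact: cmax|exact: cF].
have cm' : continuous m'.
  move=> x; apply: cvgM.
    by apply: cvgN; apply: (@continuous_comp _ _ _ (fun x => Num.max L x) F1);
      [exact: cmax|exact: cF1].
  by apply: (@continuous_comp _ _ _ m (fun z => z ^+ 2)); [exact: cm|exact: exprn_continuous].
have maxE x : L < x -> Num.max L x = x by move=> Lx; apply/max_idPr/ltW.
have Dm x : L < x -> is_derive x 1 m (m' x).
  move=> Lx; apply: (@near_eq_is_derive _ _ _ (fun y => (F y)^-1)).
    by near=> y; rewrite /m maxE//; near: y; exact: lt_nbhsr.
  have Fx : F x != 0 by rewrite gt_eqF// F0// ltW.
  apply: (is_derive_eq (is_deriveV Fx (DF x))).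
  by rewrite /m' maxE// /GRing.scale /= exprVn; ring.
have l5 := half_line_loc_L1D (half_line_loc_L1M cm lv) (half_line_loc_L1M cm' lu).
have DD := real_weak_derivativeM lu lv uv cm cm' Dm.
have [|d ud] := weak_derivative0_cst (half_line_loc_L1M cm lu)
  (real_weak_derivative_ae0 l5 _ DD).
  apply: aeS uFvF => x uvx Dx; rewrite /m /m' maxE; last by move: Dx;
    rewrite /half_line /= in_itv/= andbT.
  have Fx : F x != 0 by move: Dx; rewrite /half_line /= in_itv/= andbT => /ltW/F0;
    exact: lt0r_neq0.
  have -> : v x = u x * F1 x / F x by rewrite uvx// mulfK.
  by rewrite /=; field.
have uF : u = (fun x => d * F x) %[ae mu in half_line L].
  apply: aeS ud => x ux Dx; have /= <- := ux Dx; rewrite /m maxE; last by move: Dx;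
    rewrite /half_line /= in_itv/= andbT.
  have Fx : F x != 0 by move: Dx; rewrite /half_line /= in_itv/= andbT => /ltW/F0;
    exact: lt0r_neq0.
  by rewrite mulfVK.
(* The formula for [v] is read off the vanishing Wronskian, not obtained by differentiating that for
   [u]. *)
exists d; split => //; apply: aeS2 uF uFvF => x ux uvx Dx.
have Fx : F x != 0 by move: Dx; rewrite /half_line /= in_itv/= andbT => /ltW/F0;
  exact: lt0r_neq0.
by apply: (mulIf Fx); rewrite -uvx// ux//; ring.
Unshelve. all: by end_near. Qed.

End weak_derivatives.

(** * Boundary values and smooth functions in the weak setting *)

Section smooth_representatives.
Context {R : realType}.
Notation mu := (@lebesgue_measure R).
Implicit Types (L a b s e x : R) (f g h u v w m phi psi : R -> R).

Lemma ae_itv_ex a b (P : R -> Prop) : a < b ->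
  (\forall x \ae mu, P x) -> exists2 x, a < x < b & P x.
Proof.
move=> ab [A [mA A0 PA]]; apply: contrapT => nP.
have DA : `]a, b[%classic `<=` A.
  move=> x; rewrite /= in_itv/= => xab; apply: PA => /= Px; apply: nP; by exists x.
have : (mu `]a, b[ <= mu A)%E.
  by apply: le_measure => //; rewrite inE; [exact: measurable_itv|exact: mA].
by rewrite A0 lebesgue_measure_itv /= lte_fin ab -EFinB lee_fin leNgt subr_gt0 ab.
Qed.

Lemma near_right_itv a (P : R -> Prop) :
  (\forall x \near a^'+, P x) -> exists2 b, a < b & forall x, a < x < b -> P x.
Proof.
move=> [d /= d0 dP]; exists (a + d); first by rewrite ltrDl.
move=> x /andP[ax xd]; apply: dP => //=.
by rewrite distrC gtr0_norm ?subr_gt0// ltrBlDl.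
Qed.

(** If the values at [L] differed, the two continuous representatives would differ on an interval to
    the right of [L], which has positive measure. *)
Lemma real_boundary_value_unique L f g (c : R) : continuous g ->
  f = g %[ae mu in half_line L] -> real_boundary_value L f c -> c = g L.
Proof.
move=> cg fg [g0 [/continuous_within_itvcyP[_ cg0] fg0 <-]].
apply/eqP; rewrite -subr_eq0; apply: contraT => n0.
have C : g0 x - g x @[x --> L^'+] --> g0 L - g L.
  by apply: cvgB => //; apply: cvg_at_right_filter; exact: cg.
have /near_right_itv[b Lb bP] : \forall x \near L^'+, g0 x - g x != 0.
  exact: (cvgr_neq0 _ C n0).
have [x xLb xP] := @ae_itv_ex L b (fun x => half_line L x -> g0 x = g x) Lb
  (aeS2 (fun x A B Dx => etrans (esym (A Dx)) (B Dx)) fg0 fg).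
have := bP _ xLb; rewrite xP ?subrr ?eqxx//.
by rewrite /half_line /= in_itv/= andbT; case/andP: xLb.
Qed.

Lemma real_boundary_value_continuous L f : continuous f -> real_boundary_value L f (f L).
Proof.
move=> cf; exists f; split => //; first exact: continuous_subspaceT.
by apply: aeW.
Qed.

Lemma is_derive_real_weak_derivative L f g : (forall x : R, is_derive x 1 f (g x)) ->
  continuous g -> real_weak_derivative L f g.
Proof.
move=> D cg phi tphi; have [a [b [La s s']]] := test_function_support tphi.
have cf : continuous f by move=> x; exact: is_derive_continuous (D x).
have cp := test_function_continuous tphi.
have cp' : continuous (derive1 phi) by case: tphi.
(* The interval is enlarged strictly, so that [phi] vanishes at both ends; the maximum keeps
   [a' < b'] even when [b < a] and [phi] is identically 0. *)
pose a' := (L + a) / 2; pose b' := Num.max a b + 1.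
have La' : L < a' by rewrite /a' midf_lt.
have a'a : a' < a by rewrite /a' midf_lt.
have bb' : b < b' by rewrite /b' ltr_pwDr// le_max lexx orbT.
have ab' : a' < b' by rewrite (lt_trans a'a)// /b' ltr_pwDr// le_max lexx.
have supp h x : (h x != 0 -> a <= x <= b) -> h x != 0 -> a' <= x <= b'.
  by move=> H /H /andP[ax xb]; rewrite (le_trans (ltW a'a) ax) (le_trans xb (ltW bb')).
have mI : measurable `[a', b']%classic by exact: measurable_itv.
have i h : continuous h -> mu.-integrable `[a', b'] (EFin \o h).
  move=> ch; apply: continuous_compact_integrable; first exact: segment_compact.
  exact: continuous_subspaceT.
rewrite !(Rintegral_half_line_support La' (b := b')); last 2 first.
- by move=> x; rewrite mulf_eq0 negb_or => /andP[_]; exact: (supp phi x (s x)).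
- by move=> x; rewrite mulf_eq0 negb_or => /andP[_]; exact: (supp (derive1 phi) x (s' x)).
have Dfp (x : R) : is_derive x 1 (f * phi) (f x * derive1 phi x + g x * phi x).
  have := D x; have := test_function_is_derive x tphi => ? ?.
  by apply: is_derive_eq; rewrite /GRing.scale /= [phi x * _]mulrC.
have c1 : continuous (fun x => f x * derive1 phi x) by move=> x; apply: cvgM;
  [exact: cf|exact: cp'].
have c2 : continuous (fun x => g x * phi x) by move=> x; apply: cvgM; [exact: cg|exact: cp].
have := Rintegral_FTC2 ab' _ Dfp; rewrite RintegralD//; [|exact: i|exact: i].
have phi0 x : ~~ (a <= x <= b) -> phi x = 0.
  by move=> xab; apply/eqP; apply: contraNT xab; exact: s.
rewrite !fctE (phi0 a') ?(phi0 b').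
- rewrite !mulr0 subrr => H; apply/eqP; rewrite -addr_eq0; apply/eqP; apply: H.
  by move=> x; apply: cvgD; [exact: c1|exact: c2].
- by rewrite negb_and -!ltNge bb' orbT.
- by rewrite negb_and -!ltNge a'a.
Qed.

Lemma exponential_decay_L2 L h (c C : R) : 0 <= L -> 0 < c -> continuous h ->
  (forall x, L < x -> `|h x| <= C * expR (- (c * (x - L)))) -> real_L2 L h.
Proof.
move=> L0 c0 ch hC.
have c20 : 0 < 2 * c by rewrite mulr_gt0.
(* The square is dominated by a multiple of the exponential density of rate 2 c. This density lives
   on [0, +oo[, which is where [0 <= L] enters. *)
have i := integrableZl measurableT (C ^+ 2 * expR (2 * c * L) / (2 * c))
  (integrable_exponential_pdf c20).
have mh : measurable_fun setT (h \_ (half_line L)).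
  apply/(measurable_restrictT _ (measurable_half_line L)).
  by apply: measurable_funS (continuous_measurable_fun ch).
apply: (sqr_le_Lfun2 mh i) => x; rewrite patchE.
case: ifPn => [|_]; last first.
  rewrite expr0n /=; apply: mulr_ge0; last exact/exponential_pdf_ge0/ltW.
  by apply: divr_ge0; [rewrite mulr_ge0 ?sqr_ge0 ?expR_ge0|exact: ltW].
rewrite inE /half_line /= in_itv/= andbT => Lx.
have x0 : 0 <= x by rewrite (le_trans L0)// ltW.
rewrite exponential_pdfE//= -real_normK ?num_real//.
have -> : C ^+ 2 * expR (2 * c * L) / (2 * c) * (2 * c * expR (- (2 * c) * x)) =
   (C * expR (- (c * (x - L)))) ^+ 2.
  rewrite exprMn -expRM_natl.
  have -> : 2%:R * - (c * (x - L)) = 2 * c * L + - (2 * c) * x by ring.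
  by rewrite expRD; field; rewrite gt_eqF.
rewrite lerXn2r ?nnegrE ?hC//.
by rewrite (le_trans _ (hC _ Lx)).
Qed.

End smooth_representatives.

(** * The decaying solution on an edge *)

Section jost.
Context {R : realType}.
Implicit Types (kap t x y : R).

Definition tanh y : R := 1 - 2 / (expR (2 * y) + 1).

Lemma tanh_denom_gt0 y : 0 < expR (2 * y) + 1 :> R.
Proof. by rewrite addr_gt0 ?expR_gt0. Qed.

Lemma is_derive_tanh (y : R) : is_derive y 1 tanh (1 - tanh y ^+ 2).
Proof.
have D0 : is_derive y 1 (fun y => expR (2 * y + 0)) (expR (2 * y + 0) * 2).
  exact: is_derive_affine_comp.
have d0 := tanh_denom_gt0 y.
have D1 : is_derive y 1 ((fun y => expR (2 * y + 0)) + cst 1) (expR (2 * y + 0) * 2).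
  by apply: is_derive_eq; rewrite addr0.
have n0 : ((fun y => expR (2 * y + 0)) + cst 1) y != 0 by rewrite !fctE addr0 gt_eqF.
have D2 := is_deriveV n0 D1.
have E : tanh = cst 1 - 2 \*: (fun y => (((fun y => expR (2 * y + 0)) + cst 1) y)^-1).
  by apply/funext => z; rewrite /tanh !fctE /= addr0.
rewrite [X in is_derive _ _ X _]E.
apply: is_derive_eq; rewrite /tanh !fctE /GRing.scale /= addr0.
by field; rewrite gt_eqF.
Qed.

Lemma tanh_bounds y : -1 < tanh y < 1.
Proof.
have d0 := tanh_denom_gt0 y; have := expR_gt0 (2 * y) => e0.
rewrite /tanh; apply/andP; split.
  rewrite ltrBrDr -ltrBrDl opprK ltr_pdivrMr//; lra.
by rewrite ltrBlDr ltrDl divr_gt0.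
Qed.

Lemma tanh_gt0 y : 0 < y -> 0 < tanh y.
Proof.
move=> y0; have d0 := tanh_denom_gt0 y.
rewrite /tanh subr_gt0 ltr_pdivrMr// mul1r.
by have -> : 2 = 1 + 1 :> R by []; rewrite ltrD2r -expR0 ltr_expR mulr_gt0.
Qed.

Lemma tanh_artanh t : -1 < t < 1 -> tanh (artanh t) = t.
Proof.
move=> /andP[t1 t2]; rewrite /tanh /artanh.
have p : 0 < (1 + t) / (1 - t) by rewrite divr_gt0 ?subr_gt0//; lra.
rewrite mulrCA mulfV ?mulr1 ?lnK//.
by field; lra.
Qed.

Lemma artanh_gt0 t : 0 < t < 1 -> 0 < artanh t.
Proof.
move=> /andP[t1 t2]; rewrite /artanh divr_gt0// ln_gt0//.
rewrite ltr_pdivlMr; lra.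
Qed.

Lemma sech_sqr y : sech y ^+ 2 = 1 - tanh y ^+ 2.
Proof.
rewrite /sech /cosh /tanh (expRM_natl 2 y) expRN.
have e0 := expR_gt0 y.
have e2 : 0 < expR y ^+ 2 + 1 by rewrite addr_gt0 ?exprn_gt0.
field; rewrite ?gt_eqF//=; rewrite ?gt_eqF//.
Qed.

(* jost kap solves f'' = (kap^2 - 6 sech^2) f and decays like exp (- kap y):
   the Poeschl-Teller potential with l = 2 is reflectionless. *)
Definition jost_poly kap t : R := kap ^+ 2 - 1 + 3 * kap * t + 3 * t ^+ 2.

(** The polynomial [q] of the derivative: the exponential contributes [- kap] times [p], and tanh' =
    1 - tanh^2 contributes (1 - t^2) times the derivative of [p] in [t]. *)
Definition jost_poly' kap t : R :=
  - kap * jost_poly kap t + 3 * (1 - t ^+ 2) * (kap + 2 * t).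

Definition jost kap y : R := expR (- kap * y) * jost_poly kap (tanh y).

Definition jost' kap y : R := expR (- kap * y) * jost_poly' kap (tanh y).

Lemma is_derive_expR_tanh_poly kap (p p' : R -> R) (y : R) :
  (forall t : R, is_derive t 1 p (p' t)) ->
  is_derive y 1 (fun y => expR (- kap * y) * p (tanh y))
    (expR (- kap * y) * (- kap * p (tanh y) + p' (tanh y) * (1 - tanh y ^+ 2))).
Proof.
move=> Dp.
have D0 : is_derive y 1 (fun y => expR (- kap * y + 0)) (expR (- kap * y + 0) * - kap).
  exact: is_derive_affine_comp.
have D1 : is_derive y 1 (p \o tanh) (p' (tanh y) * (1 - tanh y ^+ 2)).
  by apply: is_derive1_comp; exact: is_derive_tanh.
have -> : (fun y => expR (- kap * y) * p (tanh y)) = (fun y =>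
  expR (- kap * y + 0)) * (p \o tanh).
  by apply/funext => z; rewrite !fctE /= addr0.
by apply: is_derive_eq; rewrite /GRing.scale /= addr0; ring.
Qed.

Lemma is_derive_jost kap (y : R) : is_derive y 1 (jost kap) (jost' kap y).
Proof.
have D (t : R) : is_derive t 1 (jost_poly kap) (3 * kap + 6 * t).
  have -> : jost_poly kap = cst (kap ^+ 2 - 1) + (3 * kap) \*: id + 3 \*: (@id R ^+ 2).
    by apply/funext => z; rewrite /jost_poly !fctE.
  by apply: is_derive_eq; rewrite /GRing.scale /= expr1; ring.
apply: (is_derive_eq (is_derive_expR_tanh_poly kap y D)).
by rewrite /jost' /jost_poly'; ring.
Qed.

Lemma is_derive_jost' kap (y : R) :
  is_derive y 1 (jost' kap) ((kap ^+ 2 - 6 * (1 - tanh y ^+ 2)) * jost kap y).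
Proof.
have D (t : R) : is_derive t 1 (jost_poly' kap)
   (- 3 * kap ^+ 2 - 12 * kap * t + 6 - 18 * t ^+ 2).
  have -> : jost_poly' kap = cst (- kap ^+ 3 + 4 * kap) + (- 3 * kap ^+ 2 + 6) \*: id
     + (- 6 * kap) \*: (@id R ^+ 2) + (- 6) \*: (@id R ^+ 3).
    apply/funext => z; rewrite /jost_poly' /jost_poly !fctE.
    transitivity (- kap ^+ 3 + 4 * kap + (- 3 * kap ^+ 2 + 6) * z + (- 6 * kap) * z ^+ 2 +
      (- 6) * z ^+ 3); last by [].
    ring.
  by apply: is_derive_eq; rewrite /GRing.scale /= expr1; ring.
apply: (is_derive_eq (is_derive_expR_tanh_poly kap y D)).
by rewrite /jost /jost_poly' /jost_poly; ring.
Qed.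

Lemma continuous_tanh : continuous (tanh : R -> R).
Proof. by move=> y; exact: is_derive_continuous (is_derive_tanh y). Qed.

Lemma jost_bound kap y : 0 <= kap ->
  `|jost kap y| <= (kap ^+ 2 + 3 * kap + 4) * expR (- kap * y).
Proof.
move=> k0; rewrite /jost normrM gtr0_norm ?expR_gt0// mulrC.
rewrite ler_wpM2r ?expR_ge0// ler_norml /jost_poly.
have /andP[t1 t2] := tanh_bounds y.
move: (tanh y) t1 t2 => t t1 t2; apply/andP; split; nra.
Qed.

Lemma jost'_bound kap y : 0 <= kap ->
  `|jost' kap y| <= (kap * (kap ^+ 2 + 3 * kap + 4) + 3 * kap + 6) * expR (- kap * y).
Proof.
move=> k0; rewrite /jost' normrM gtr0_norm ?expR_gt0// mulrC.
rewrite ler_wpM2r ?expR_ge0// ler_norml /jost_poly' /jost_poly.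
have /andP[t1 t2] := tanh_bounds y.
move: (tanh y) t1 t2 => t t1 t2.
have tt : 0 <= t ^+ 2 <= 1 by rewrite sqr_ge0 /=; nra.
have P1 : `|kap ^+ 2 - 1 + 3 * kap * t + 3 * t ^+ 2| <= kap ^+ 2 + 3 * kap + 4.
  by rewrite ler_norml; apply/andP; split; nra.
have P2 : `|3 * (1 - t ^+ 2) * (kap + 2 * t)| <= 3 * kap + 6.
  rewrite -mulrA normrM ger0_norm ?ler0n// -[X in _ <= X](_ : 3 * (kap + 2) = _); last by ring.
  rewrite ler_wpM2l// normrM -[leRHS]mul1r ler_pM//; rewrite ler_norml; apply/andP; split; lra.
move: P1 P2; set A := _ - 1 + _ + _; set B := 3 * _ * _.
rewrite !ler_norml => /andP[A1 A2] /andP[B1 B2]; apply/andP; split; nra.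
Qed.

Lemma jost_gt0 kap y : 1 < kap -> 0 < y -> 0 < jost kap y.
Proof.
move=> k1 /tanh_gt0 t0; rewrite /jost mulr_gt0 ?expR_gt0// /jost_poly; nra.
Qed.

End jost.

(** * Roots of the vertex equation *)

Section jost_roots.
Context {R : realType}.
Implicit Types (kap x y t : R).

Lemma jost_poly_gt0 t x : 0 < t -> 1 <= x -> 0 < jost_poly x t.
Proof. by move=> t0 x1; rewrite /jost_poly; nra. Qed.

(** Monotonicity of [p / q] in [kap] with the denominators cleared: the difference of the two sides
    factors as [y - x] times a positive polynomial, whatever the signs of [q]. *)
Lemma jost_poly_cross t x y : 0 < t < 1 -> 1 <= x -> x < y ->
  jost_poly x t * jost_poly' y t < jost_poly y t * jost_poly' x t.
Proof.
move=> /andP[t0 t1] x1 xy; have y1 := le_trans x1 (ltW xy).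
rewrite -subr_gt0.
have -> : jost_poly y t * jost_poly' x t - jost_poly x t * jost_poly' y t =
  (y - x) * (jost_poly x t * jost_poly y t +
    3 * (1 - t ^+ 2) * (x * y + 2 * t * (x + y) + 3 * t ^+ 2 + 1)).
  by rewrite /jost_poly' /jost_poly; ring.
rewrite mulr_gt0 ?subr_gt0// addr_gt0 ?mulr_gt0 ?jost_poly_gt0 ?subr_gt0//; nra.
Qed.

(** As [p] is positive, the crossed inequality gives p(x) q(y) < p(y) q(x) <= 0. Hence [q] changes
    sign at most once beyond 1, from plus to minus. *)
Lemma jost_poly'_lt0 t x y : 0 < t < 1 -> 1 <= x -> x < y ->
  jost_poly' x t <= 0 -> jost_poly' y t < 0.
Proof.
move=> t01 x1 xy qx; have := jost_poly_cross t01 x1 xy.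
have /andP[t0 _] := t01.
have := jost_poly_gt0 t0 x1; have := jost_poly_gt0 t0 (le_trans x1 (ltW xy)).
nra.
Qed.

Definition jost_ratio x t : R := jost_poly x t / jost_poly' x t.

Lemma jost_ratio_lt t x y : 0 < t < 1 -> 1 <= x -> x < y ->
  0 < jost_poly' x t * jost_poly' y t -> jost_ratio x t < jost_ratio y t.
Proof.
move=> t01 x1 xy qq.
have qx : jost_poly' x t != 0 by move: qq; apply: contraTneq => ->; rewrite mul0r ltxx.
have qy : jost_poly' y t != 0 by move: qq; apply: contraTneq => ->; rewrite mulr0 ltxx.
rewrite /jost_ratio -subr_gt0.
have -> : jost_poly y t / jost_poly' y t - jost_poly x t / jost_poly' x t =
  (jost_poly y t * jost_poly' x t - jost_poly x t * jost_poly' y t) /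
    (jost_poly' x t * jost_poly' y t).
  by field; rewrite ?qx ?qy.
by rewrite divr_gt0 // subr_gt0; exact: jost_poly_cross.
Qed.

(** The origin of the threshold: at energy 0 the sign changes at t^2 = 1/2, where [alpha] equals
    sqrt 2 N, which corresponds to omega = 2 N^2 / Z^2. *)
Lemma jost_poly'_1 t : jost_poly' 1 t = 3 * (1 + t) * (1 - 2 * t ^+ 2).
Proof. by rewrite /jost_poly' /jost_poly; ring. Qed.

(** The value is - 6 t (1 + t)^2; a pole beyond 1 therefore lies between 1 and 2. *)
Lemma jost_poly'_2 t : 0 < t -> jost_poly' 2 t < 0.
Proof. by move=> t0; rewrite /jost_poly' /jost_poly; nra. Qed.

(** [q] is [- x * p] plus a term of degree one in [x]; from [x = 4] on the latter is at most half of
    [x * p], since 6 (x + 2) <= x (x^2 - 1). *)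
Lemma jost_poly'_large t x : 0 < t < 1 -> 4 <= x ->
  jost_poly' x t < 0 /\ - (2 / x) <= jost_ratio x t.
Proof.
move=> /andP[t0 t1] x4; have x0 : 0 < x by lra.
have p0 : 0 < jost_poly x t by apply: jost_poly_gt0 => //; lra.
have q0 : jost_poly' x t <= - (x / 2) * jost_poly x t.
  have pp : x ^+ 2 - 1 <= jost_poly x t by rewrite /jost_poly; nra.
  have bd : 3 * (1 - t ^+ 2) * (x + 2 * t) <= 3 * (x + 2) by nra.
  have : 6 * (x + 2) <= x * (x ^+ 2 - 1) by nra.
  rewrite /jost_poly'; move: (jost_poly x t) pp p0 => p pp p0; nra.
have q1 : jost_poly' x t < 0.
  by apply: le_lt_trans q0 _; rewrite mulNr oppr_lt0 mulr_gt0// divr_gt0.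
split => //; rewrite /jost_ratio -subr_ge0.
have -> : jost_poly x t / jost_poly' x t - - (2 / x) =
  (- (x / 2) * jost_poly x t - jost_poly' x t) * (2 / x) / (- jost_poly' x t).
  by field; rewrite lt_eqF//= gt_eqF.
apply: divr_ge0; last by rewrite oppr_ge0 ltW.
by apply: mulr_ge0; [rewrite subr_ge0|apply/ltW/divr_gt0].
Qed.

(** [p] and [q] as polynomials in [kap], with [t] as a parameter, for use with the intermediate
    value theorem for polynomials. *)
Definition jost_polyX t : {poly R} := 'X^2 - 1 + (3 * t) *: 'X + (3 * t ^+ 2)%:P.
Definition jost_polyX' t : {poly R} :=
  - 'X * jost_polyX t + (3 * (1 - t ^+ 2)) *: ('X + (2 * t)%:P).

Lemma horner_jost_polyX t x : (jost_polyX t).[x] = jost_poly x t.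
Proof. by rewrite /jost_polyX /jost_poly !hornerE; ring. Qed.

Lemma horner_jost_polyX' t x : (jost_polyX' t).[x] = jost_poly' x t.
Proof. by rewrite /jost_polyX' /jost_polyX /jost_poly' /jost_poly !hornerE; ring. Qed.

Lemma poly_ivt_lt (p : {poly R}) (a b : R) : a < b -> p.[a] * p.[b] < 0 ->
  exists2 x, a < x < b & p.[x] = 0.
Proof.
move=> ab pab.
have pa0 : p.[a] != 0 by move: pab; apply: contraTneq => ->; rewrite mul0r ltxx.
have pb0 : p.[b] != 0 by move: pab; apply: contraTneq => ->; rewrite mulr0 ltxx.
have [x] : exists2 x, a <= x <= b & p.[x] = 0.
  have [pa|pa] := ltP 0 p.[a].
    have pb : p.[b] <= 0 by move: pab; rewrite pmulr_rlt0// => /ltW.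
    have [|x xab] := @poly_ivt _ (- p) a b (ltW ab).
      by rewrite !hornerN oppr_le0 (ltW pa) oppr_ge0.
    by rewrite rootE hornerN oppr_eq0 => /eqP; exists x.
  have pa' : p.[a] < 0 by rewrite lt_neqAle pa0.
  have pb : 0 <= p.[b] by move: pab; rewrite nmulr_rlt0// => /ltW.
  have [|x xab] := @poly_ivt _ p a b (ltW ab); first by rewrite pa.
  by rewrite rootE => /eqP; exists x.
move=> /andP[ax xb] px; exists x => //.
rewrite !lt_neqAle ax xb !andbT; apply/andP; split.
  by apply: contraNneq pa0 => ->; rewrite px.
by apply: contraNneq pb0 => <-; rewrite px.
Qed.

Lemma jost_poly'_root t : 0 < t < 1 -> 2 * t ^+ 2 < 1 -> exists r,
  [/\ 1 < r, jost_poly' r t = 0, forall x, 1 <= x < r -> 0 < jost_poly' x t &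
     forall x, r < x -> jost_poly' x t < 0].
Proof.
move=> t01 t2; have /andP[t0 t1] := t01.
have q1 : 0 < jost_poly' 1 t by rewrite jost_poly'_1; nra.
have [||r /andP[r1 r2]] := @poly_ivt_lt (jost_polyX' t) 1 2.
- by rewrite ltr1n.
- by rewrite !horner_jost_polyX' pmulr_rlt0// jost_poly'_2.
rewrite horner_jost_polyX' => qr; exists r; split => // x.
  move=> /andP[x1 xr]; rewrite ltNge; apply/negP => qx.
  by have := jost_poly'_lt0 t01 x1 xr qx; rewrite qr ltxx.
by move=> rx; apply: (jost_poly'_lt0 t01 (ltW r1)) => //; rewrite qr.
Qed.

Definition jost_sum (a b t s alp x : R) : R := a * jost_ratio x t + b * jost_ratio x s + alp.

(** [jost_sum] cleared of denominators. At a zero of one denominator a single term survives, and its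
    sign does the work of the infinite one-sided limits. *)
Definition jost_sumX (a b t s alp : R) : {poly R} :=
  a *: (jost_polyX t * jost_polyX' s) + b *: (jost_polyX s * jost_polyX' t) +
  alp *: (jost_polyX' t * jost_polyX' s).

Lemma horner_jost_sumX a b t s alp x :
  (jost_sumX a b t s alp).[x] = a * (jost_poly x t * jost_poly' x s) +
    b * (jost_poly x s * jost_poly' x t) + alp * (jost_poly' x t * jost_poly' x s).
Proof. by rewrite /jost_sumX 2!hornerD !hornerZ !hornerM !horner_jost_polyX
  !horner_jost_polyX'. Qed.

Lemma jost_sumXE a b t s alp x : jost_poly' x t != 0 -> jost_poly' x s != 0 ->
  (jost_sumX a b t s alp).[x] = jost_poly' x t * jost_poly' x s * jost_sum a b t s alp x.
Proof.
move=> qt qs; rewrite horner_jost_sumX /jost_sum /jost_ratio.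
by field; rewrite ?qt ?qs.
Qed.

Lemma jost_sum_lt a b t s alp x y : 0 < t < 1 -> 0 < s < 1 -> 0 < a -> 0 < b ->
  1 <= x -> x < y -> 0 < jost_poly' x t * jost_poly' y t ->
  0 < jost_poly' x s * jost_poly' y s -> jost_sum a b t s alp x < jost_sum a b t s alp y.
Proof.
move=> t01 s01 a0 b0 x1 xy qt qs; rewrite /jost_sum ltrD2r.
have := jost_ratio_lt t01 x1 xy qt; have := jost_ratio_lt s01 x1 xy qs; nra.
Qed.

Lemma jost_sum_large a b t s alp x0 : 0 < t < 1 -> 0 < s < 1 -> 0 < a -> 0 < b -> 0 < alp ->
  exists x, [/\ x0 < x, jost_poly' x t < 0, jost_poly' x s < 0 & 0 < jost_sum a b t s alp x].
Proof.
(* The three summands make [jost_poly'_large] applicable, put [x] beyond [x0], and keep the lower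
   bound - (a + b) (2 / x) of the two ratios above [- alp]. *)
move=> t01 s01 a0 b0 l0; pose x := 4 + `|x0| + 2 * (a + b) / alp.
have e0 : 0 < 2 * (a + b) / alp by rewrite divr_gt0 ?mulr_gt0 ?addr_gt0.
have x4 : 4 <= x by rewrite /x; have := normr_ge0 x0; lra.
exists x; have [qt rt] := jost_poly'_large t01 x4; have [qs rs] := jost_poly'_large s01 x4.
split => //; first by rewrite /x; have := ler_norm x0; lra.
have x0' : 0 < x by lra.
have lx : (a + b) * (2 / x) < alp.
  rewrite mulrA ltr_pdivrMr// [_ * 2]mulrC /x !mulrDr [alp * (_ / _)]mulrC mulfVK ?gt_eqF//.
  have := mulr_gt0 l0 (ltr0n R 4); have := mulr_ge0 (ltW l0) (normr_ge0 x0); lra.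
rewrite /jost_sum; move: (2 / x) rt rs lx => c; nra.
Qed.

(* Beyond the pole r the sum increases from -oo to its limit alp > 0 at +oo. *)
Lemma jost_sum_root_right a b t s alp r : 0 < t < 1 -> 0 < s < 1 -> 0 < a -> 0 < b ->
  0 < alp -> 1 <= r -> jost_poly' r t = 0 -> jost_poly' r s < 0 ->
  exists x, [/\ r < x, jost_sum a b t s alp x = 0 &
     forall y, r < y -> jost_sum a b t s alp y = 0 -> y = x].
Proof.
move=> t01 s01 a0 b0 l0 r1 qr qs.
have qt0 x : r < x -> jost_poly' x t < 0.
  by move=> rx; apply: (jost_poly'_lt0 t01 r1 rx); rewrite qr.
have qs0 x : r < x -> jost_poly' x s < 0.
  by move=> rx; apply: (jost_poly'_lt0 s01 r1 rx); exact: ltW.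
have [c [rc qtc qsc sc]] := jost_sum_large r t01 s01 a0 b0 l0.
have t0 : 0 < t by case/andP: t01.
have [|x /andP[rx xc]] := @poly_ivt_lt (jost_sumX a b t s alp) r c rc.
  rewrite [X in _ * X]jost_sumXE ?lt_eqF// horner_jost_sumX qr.
  rewrite !mul0r !mulr0 !addr0.
  have X1 : a * (jost_poly r t * jost_poly' r s) < 0.
    by rewrite pmulr_rlt0// pmulr_rlt0// jost_poly_gt0.
  have X2 : 0 < jost_poly' c t * jost_poly' c s by rewrite nmulr_rgt0.
  by rewrite nmulr_rlt0// mulr_gt0.
rewrite jost_sumXE ?lt_eqF ?qt0 ?qs0// => /eqP.
rewrite !mulf_eq0 (lt_eqF (qt0 _ rx)) (lt_eqF (qs0 _ rx)) /= => /eqP xr.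
exists x; split => // y ry yr; apply/eqP; rewrite eq_le !leNgt; apply/andP; split;
  apply/negP => xy.
  have := @jost_sum_lt a b t s alp x y t01 s01 a0 b0 (ltW (le_lt_trans r1 rx)) xy.
  by rewrite xr yr ltxx !nmulr_rgt0 ?qt0 ?qs0// => /(_ isT isT).
have := @jost_sum_lt a b t s alp y x t01 s01 a0 b0 (ltW (le_lt_trans r1 ry)) xy.
by rewrite xr yr ltxx !nmulr_rgt0 ?qt0 ?qs0// => /(_ isT isT).
Qed.

Section left_of_root.
Context (a b t s alp r : R).
Hypotheses (t01 : 0 < t < 1) (s01 : 0 < s < 1) (a0 : 0 < a) (b0 : 0 < b) (r1 : 1 < r)
  (qr : jost_poly' r t = 0) (qt : forall x, 1 <= x < r -> 0 < jost_poly' x t)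
  (qs : forall x, 1 <= x -> jost_poly' x s < 0).

Let sum_lt x y : 1 <= x -> x < y -> y < r ->
  jost_sum a b t s alp x < jost_sum a b t s alp y.
Proof.
move=> x1 xy yr; apply: jost_sum_lt => //.
  by rewrite mulr_gt0 ?qt ?x1 ?(lt_trans xy yr)// (le_trans x1 (ltW xy)).
by rewrite nmulr_rgt0 qs// (le_trans x1 (ltW xy)).
Qed.

Lemma jost_sum_noroot_left x : 0 < jost_sum a b t s alp 1 -> 1 < x < r ->
  jost_sum a b t s alp x != 0.
Proof.
move=> s1 /andP[x1 xr]; rewrite gt_eqF// (lt_trans s1)//; exact: sum_lt.
Qed.

(** Left of [r] the two denominators have opposite signs, so a negative sum at 1 makes the cleared
    polynomial positive there. At [r] only the term with [jost_poly r t] is left; it is negative, in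
    place of the limit +oo of the sum. *)
Lemma jost_sum_root_left : jost_sum a b t s alp 1 < 0 ->
  exists x, [/\ 1 < x < r, jost_sum a b t s alp x = 0 &
     forall y, 1 < y < r -> jost_sum a b t s alp y = 0 -> y = x].
Proof.
move=> s1; have t0 : 0 < t by case/andP: t01.
have q1 : 0 < jost_poly' 1 t by rewrite qt ?lexx.
have [|x /andP[x1 xr]] := @poly_ivt_lt (jost_sumX a b t s alp) 1 r r1.
  rewrite jost_sumXE ?(gt_eqF q1) ?(lt_eqF (qs (lexx 1)))//.
  rewrite horner_jost_sumX qr !mul0r !mulr0 !addr0.
  have X1 : a * (jost_poly r t * jost_poly' r s) < 0.
    by rewrite pmulr_rlt0// pmulr_rlt0 ?qs ?jost_poly_gt0// ltW.
  have X2 : jost_poly' 1 t * jost_poly' 1 s < 0 by rewrite pmulr_rlt0// qs.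
  by rewrite pmulr_rlt0// nmulr_rgt0.
have qtx : 0 < jost_poly' x t by rewrite qt// (ltW x1).
have qsx : jost_poly' x s < 0 by rewrite qs// ltW.
rewrite jost_sumXE ?(gt_eqF qtx) ?(lt_eqF qsx)// => /eqP.
rewrite !mulf_eq0 (gt_eqF qtx) (lt_eqF qsx) /= => /eqP xs.
exists x; split => //; first by rewrite x1.
move=> y /andP[y1 yr] ys; apply/eqP; rewrite eq_le !leNgt; apply/andP; split; apply/negP => xy.
  by have := sum_lt (ltW x1) xy yr; rewrite xs ys ltxx.
by have := sum_lt (ltW y1) xy xr; rewrite xs ys ltxx.
Qed.

End left_of_root.

(** The case of equal sides: the pole sits at 1 itself. Clearing both denominators would produce a
    polynomial that vanishes at 1, so only one factor is cleared, and the value of [K] at 1 is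
    positive. *)
Lemma jost_sum_root_diag a b t alp : 0 < t < 1 -> 0 < a -> 0 < b -> 0 < alp ->
  jost_poly' 1 t = 0 ->
  exists x, [/\ 1 < x, jost_sum a b t t alp x = 0 &
     forall y, 1 < y -> jost_sum a b t t alp y = 0 -> y = x].
Proof.
move=> t01 a0 b0 l0 q1; have t0 : 0 < t by case/andP: t01.
have qt x : 1 < x -> jost_poly' x t < 0.
  by move=> x1; apply: (jost_poly'_lt0 t01 (lexx 1) x1); rewrite q1.
have [c [c1 qc _ sc]] := jost_sum_large 1 t01 t01 a0 b0 l0.
pose K := (a + b) *: jost_polyX t + alp *: jost_polyX' t.
have KE x : K.[x] = (a + b) * jost_poly x t + alp * jost_poly' x t.
  by rewrite /K hornerD !hornerZ horner_jost_polyX horner_jost_polyX'.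
have KS x : 1 < x -> K.[x] = jost_poly' x t * jost_sum a b t t alp x.
  move=> /qt qx; rewrite KE /jost_sum /jost_ratio; field; by rewrite lt_eqF.
have [|x /andP[x1 xc]] := @poly_ivt_lt K 1 c c1.
  rewrite (KS _ c1) KE q1 mulr0 addr0.
  have X1 : 0 < (a + b) * jost_poly 1 t.
    by apply: mulr_gt0; [exact: addr_gt0|exact: jost_poly_gt0].
  by rewrite pmulr_rlt0// pmulr_llt0.
rewrite (KS _ x1) => /eqP; rewrite mulf_eq0 (lt_eqF (qt _ x1)) /= => /eqP xs.
exists x; split => // y y1 ys; apply/eqP; rewrite eq_le !leNgt; apply/andP; split;
  apply/negP => xy.
  have := @jost_sum_lt a b t t alp x y t01 t01 a0 b0 (ltW x1) xy.
  by rewrite xs ys ltxx !nmulr_rgt0 ?qt// => /(_ isT isT).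
have := @jost_sum_lt a b t t alp y x t01 t01 a0 b0 (ltW y1) xy.
by rewrite xs ys ltxx !nmulr_rgt0 ?qt// => /(_ isT isT).
Qed.

(** The constant is the value of [alpha], as the choice of t1 dictates. The numerator is - t^2 s^3
    times the derivative of a / t + b / sqrt (1 - t^2), so its sign tells on which side of the
    minimiser [t] lies. *)
Lemma jost_sum_1 a b t s : 0 < t < 1 -> 0 < s -> s ^+ 2 = 1 - t ^+ 2 -> 2 * t ^+ 2 != 1 ->
  jost_sum a b t s (a / t + b / s) 1 =
  (a * s ^+ 3 - b * t ^+ 3) / ((1 - 2 * t ^+ 2) * t * s).
Proof.
move=> /andP[t0 t1] s0 st t2.
have n1 : 1 - 2 * t ^+ 2 != 0 by rewrite subr_eq0 eq_sym.
have tn : t != 0 by rewrite gt_eqF.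
have sn : s != 0 by rewrite gt_eqF.
(* At [kap = 1] the factor 3 (1 + u) is common to [p] and [q] and cancels. *)
have rE u : 0 < u -> 1 - 2 * u ^+ 2 != 0 -> jost_ratio 1 u = u / (1 - 2 * u ^+ 2).
  move=> u0 nu; rewrite /jost_ratio jost_poly'_1 /jost_poly.
  field; rewrite nu/=; have u1 : 0 < 1 + u by lra.
  by rewrite gt_eqF.
have sE : 1 - 2 * s ^+ 2 = - (1 - 2 * t ^+ 2) by rewrite st; ring.
rewrite /jost_sum !rE ?sE ?oppr_eq0//.
have -> : a * s ^+ 3 = a * (s * (1 - t ^+ 2)) by rewrite -st; ring.
have -> : b * (s / - (1 - 2 * t ^+ 2)) = - b * (s ^+ 2 / (s * (1 - 2 * t ^+ 2))).
  move: (1 - _) n1 => D n1.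
  by field; rewrite ?sn ?n1.
by rewrite st; field; rewrite ?tn ?sn ?n1.
Qed.

End jost_roots.

(** * Eigenspaces on the star graph *)

Section edge.
Context {R : realType}.
Notation mu := (@lebesgue_measure R).
Variables (L omega kap a : R).
Implicit Types (x : R) (u v w : R -> R).
Let k := Num.sqrt omega.
Let arg x := k * (x - L) + a.

Definition edge x : R := jost kap (arg x).
Definition edge' x : R := k * jost' kap (arg x).
Definition edge'' x : R := k ^+ 2 * ((kap ^+ 2 - 6 * (1 - tanh (arg x) ^+ 2)) * jost kap
  (arg x)).

Lemma argE x : arg x = k * x + (a - k * L).
Proof. by rewrite /arg; ring. Qed.

Lemma is_derive_arg_comp (f : R -> R) (d x : R) : is_derive (arg x) 1 f d ->
  is_derive x 1 (fun y => f (arg y)) (k * d).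
Proof.
rewrite argE => D; rewrite mulrC (_ : (fun y => _) = fun y => f (k * y + (a - k * L))).
  exact: is_derive_affine_comp.
by apply/funext => y; rewrite argE.
Qed.

Lemma is_derive_edge (x : R) : is_derive x 1 edge (edge' x).
Proof. exact: is_derive_arg_comp (is_derive_jost _ _). Qed.

Lemma is_derive_edge' (x : R) : is_derive x 1 edge' (edge'' x).
Proof.
have D := is_derive_arg_comp (is_derive_jost' kap (arg x)).
have -> : edge' = k \*: (fun y => jost' kap (arg y)) by [].
by apply: is_derive_eq; rewrite /edge'' /GRing.scale /=; ring.
Qed.

Lemma continuous_edge : continuous edge.
Proof. by move=> x; exact: is_derive_continuous (is_derive_edge x). Qed.

Lemma continuous_edge' : continuous edge'.
Proof. by move=> x; exact: is_derive_continuous (is_derive_edge' x). Qed.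

Lemma continuous_edge'' : continuous edge''.
Proof.
have ca : continuous arg.
  move=> x; apply: cvgD; last exact: cvg_cst.
  by apply: cvgM; [exact: cvg_cst|apply: cvgB; [exact: cvg_id|exact: cvg_cst]].
move=> x; apply: cvgM; first exact: cvg_cst.
apply: cvgM; last exact: continuous_edge.
apply: cvgB; first exact: cvg_cst.
apply: cvgM; first exact: cvg_cst.
apply: cvgB; first exact: cvg_cst.
apply: (@continuous_comp _ _ _ (fun x => tanh (arg x)) (fun z => z ^+ 2));
  last exact: exprn_continuous.
by apply: (@continuous_comp _ _ _ arg tanh); [exact: ca|exact: continuous_tanh].
Qed.

Hypotheses (L0 : 0 <= L) (omega0 : 0 < omega) (kap1 : 1 < kap) (a0 : 0 < a).

Let k0 : 0 < k. Proof. by rewrite sqrtr_gt0. Qed.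
Let kap0 : 0 <= kap. Proof. exact: le_trans ler01 (ltW kap1). Qed.

Lemma edge_gt0 x : L <= x -> 0 < edge x.
Proof.
move=> Lx; apply: jost_gt0 => //; rewrite /arg ltr_wpDl// mulr_ge0 ?subr_ge0//.
exact: ltW.
Qed.

Let decay_L2 (h : R -> R) (C : R) : continuous h ->
  (forall x, `|h x| <= C * expR (- kap * arg x)) -> real_L2 L h.
Proof.
move=> ch hC; apply: (@exponential_decay_L2 _ _ _ (kap * k) (C * expR (- kap * a))) => //.
  by rewrite mulr_gt0// (lt_trans ltr01).
move=> x _; apply: le_trans (hC x) _; rewrite -mulrA -expRD /arg.
by rewrite (_ : - kap * (k * (x - L) + a) = - kap * a - kap * k * (x - L))//; ring.
Qed.

Lemma edge_L2 : real_L2 L edge.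
Proof.
apply: decay_L2 continuous_edge _ => x.
exact: jost_bound.
Qed.

Lemma edge'_L2 : real_L2 L edge'.
Proof.
apply: (decay_L2 (C := k * (kap *
  (kap ^+ 2 + 3 * kap + 4) + 3 * kap + 6)) continuous_edge') => x.
by rewrite /edge' normrM gtr0_norm// -mulrA ler_pM2l// jost'_bound.
Qed.

Lemma edge''_L2 : real_L2 L edge''.
Proof.
apply: (decay_L2 (C := k ^+ 2 * ((kap ^+ 2 + 6) *
  (kap ^+ 2 + 3 * kap + 4))) continuous_edge'') => x.
rewrite /edge'' normrM gtr0_norm ?exprn_gt0// -[leRHS]mulrA ler_pM2l ?exprn_gt0//.
rewrite normrM -[leRHS]mulrA ler_pM ?normr_ge0 ?jost_bound//.
have /andP[t1 t2] := tanh_bounds (arg x).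
rewrite ler_norml; move: (tanh _) t1 t2 => t t1 t2; apply/andP; split; nra.
Qed.

Lemma Psi_sqr x : Psi L omega a x ^+ 2 = 2 * omega * (1 - tanh (arg x) ^+ 2).
Proof. by rewrite /Psi exprMn sqr_sqrtr ?sech_sqr// mulr_ge0// ltW. Qed.

(** Here 3 [Psi]^2 is 6 omega sech^2, the well with l (l + 1) = 6; the dilation by sqrt omega
    multiplies the equation of [jost] by omega. *)
Lemma edge''E x : edge'' x =
  (omega - 3 * Psi L omega a x ^+ 2 - omega * (1 - kap ^+ 2)) * edge x.
Proof.
rewrite Psi_sqr /edge'' /k sqr_sqrtr ?ltW// /edge; ring.
Qed.

Lemma real_eigenfunction u v w : real_L2 L u -> real_L2 L v -> real_L2 L w ->
  real_weak_derivative L u v -> real_weak_derivative L v w ->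
  (fun x => omega * (1 - kap ^+ 2) * u x) =
  (fun x => - w x + (omega - 3 * Psi L omega a x ^+ 2) * u x) %[ae mu in half_line L] ->
  exists c : R, u = (fun x => c * edge x) %[ae mu in half_line L] /\
    v = (fun x => c * edge' x) %[ae mu in half_line L].
Proof.
move=> u2 v2 w2 uv vw E.
apply: (decaying_solution_unique is_derive_edge is_derive_edge' continuous_edge''
  edge_gt0 edge_L2 edge'_L2 u2 v2 w2 uv vw).
apply: aeS E => x Ex Dx; rewrite edge''E [RHS]mulrA; congr (_ * _).
by rewrite [RHS]mulrC mulrBl (Ex Dx) /=; ring.
Qed.

Lemma edge_vertex : edge L = expR (- kap * a) * jost_poly kap (tanh a).
Proof. by rewrite /edge /arg subrr mulr0 add0r. Qed.

Lemma edge'_vertex : edge' L = k * (expR (- kap * a) * jost_poly' kap (tanh a)).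
Proof. by rewrite /edge' /arg subrr mulr0 add0r. Qed.

End edge.

Section graph_eigenfunctions.
Context {R : realType} {N : nat}.
Notation mu := (@lebesgue_measure R).
Notation C := R[i].
Variables (L Z omega : R) (a : 'I_N -> R).
Implicit Types (c : 'I_N -> C) (u v : @graph_fun R N) (kap : R).

Lemma ReMr (z : C) (r : R) : complex.Re (z * r%:C) = complex.Re z * r.
Proof. by case: z => x y /=; rewrite mulr0 subr0. Qed.

Lemma ImMr (z : C) (r : R) : complex.Im (z * r%:C) = complex.Im z * r.
Proof. by case: z => x y /=; rewrite mulr0 add0r. Qed.

Lemma ReMl (z : C) (r : R) : complex.Re (r%:C * z) = r * complex.Re z.
Proof. by rewrite mulrC ReMr mulrC. Qed.

Lemma ImMl (z : C) (r : R) : complex.Im (r%:C * z) = r * complex.Im z.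
Proof. by rewrite mulrC ImMr mulrC. Qed.

Lemma eq_ReIm (z w : C) : complex.Re z = complex.Re w -> complex.Im z = complex.Im w -> z = w.
Proof. by case: z w => x y [x' y'] /= -> ->. Qed.

Lemma re_partMr (z : C) (f : R -> R) :
  re_part (fun x => z * (f x)%:C) = (fun x => complex.Re z * f x).
Proof. by apply/funext => x; rewrite /re_part ReMr. Qed.

Lemma im_partMr (z : C) (f : R -> R) :
  im_part (fun x => z * (f x)%:C) = (fun x => complex.Im z * f x).
Proof. by apply/funext => x; rewrite /im_part ImMr. Qed.

Lemma real_L2_scale (r : R) (f : R -> R) : real_L2 L f -> real_L2 L (fun x => r * f x).
Proof.
move=> f2; rewrite /real_L2 (_ : _ \_ _ = r \o* (f \_ (half_line L))).
  by apply: Lfun_scale => //; rewrite ler1n.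
by apply/funext => x /=; rewrite !patchE; case: ifP; rewrite ?mul0r// mulrC.
Qed.

Lemma L2_scale (z : C) (f : R -> R) : real_L2 L f -> L2 L (fun x => z * (f x)%:C).
Proof. by move=> f2; split; rewrite ?re_partMr ?im_partMr; exact: real_L2_scale. Qed.

Lemma real_weak_derivative_scale (r : R) (f g : R -> R) :
  (forall x : R, is_derive x 1 f (g x)) -> continuous g ->
  real_weak_derivative L (fun x => r * f x) (fun x => r * g x).
Proof.
move=> D cg.
have D' (x : R) : is_derive x 1 (fun x => r * f x) (r * g x).
  have := D x => ?.
  rewrite (_ : (fun x => r * f x) = r \*: f)//.
  by apply: is_derive_eq.
apply: is_derive_real_weak_derivative D' _ => x.
by apply: cvgM; [exact: cvg_cst|exact: cg].
Qed.

Lemma weak_derivative_scale (z : C) (f g : R -> R) :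
  (forall x : R, is_derive x 1 f (g x)) -> continuous g ->
  weak_derivative L (fun x => z * (f x)%:C) (fun x => z * (g x)%:C).
Proof.
move=> D cg; split; rewrite ?re_partMr ?im_partMr; exact: real_weak_derivative_scale.
Qed.

Lemma boundary_value_scale (z : C) (f : R -> R) : continuous f ->
  boundary_value L (fun x => z * (f x)%:C) (z * (f L)%:C).
Proof.
move=> cf; have cr (r : R) : continuous (fun x => r * f x).
  by move=> x; apply: cvgM; [exact: cvg_cst|exact: cf].
split; rewrite ?re_partMr ?im_partMr ?ReMr ?ImMr;
  exact: (@real_boundary_value_continuous _ L (fun x => _ * f x)).
Qed.

Definition graph_edge kap c : @graph_fun R N :=
  fun j x => c j * (edge L omega kap (a j) x)%:C.

Definition vertex_coef kap : set ('I_N -> C) := [set c | exists d : C,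
  (forall j, c j * (edge' L omega kap (a j) L)%:C = d) /\
  \sum_j c j * (edge L omega kap (a j) L)%:C = Z%:C * d].

Definition sech_potential (j : 'I_N) (x : R) : R := omega - 3 * Psi L omega (a j) x ^+ 2.

Hypotheses (L0 : 0 <= L) (omega0 : 0 < omega) (a0 : forall j, 0 < a j).

Lemma graph_edge_derivatives kap c j : 1 < kap ->
  H2_derivatives L (graph_edge kap c j) (fun x => c j * (edge' L omega kap (a j) x)%:C)
    (fun x => c j * (edge'' L omega kap (a j) x)%:C).
Proof.
move=> k1; split.
- exact/L2_scale/edge_L2.
- exact/L2_scale/edge'_L2.
- exact/L2_scale/edge''_L2.
- apply: weak_derivative_scale; [exact: is_derive_edge|exact: continuous_edge'].
- apply: weak_derivative_scale; [exact: is_derive_edge'|exact: continuous_edge''].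
Qed.

Lemma vertex_coef_eigenfunction kap c : 1 < kap -> vertex_coef kap c ->
  operator_eigenspace (schroedinger_delta' L Z sech_potential) (omega * (1 - kap ^+ 2))
    (graph_edge kap c).
Proof.
move=> k1 [d [cd cs]]; split.
- split.
    move=> j; eexists; eexists; exact: graph_edge_derivatives.
  exists (fun j x => c j * (edge' L omega kap (a j) x)%:C).
  exists (fun j => c j * (edge L omega kap (a j) L)%:C), d; split => // j.
  + by have [_ ? _ ? _] := graph_edge_derivatives c j k1.
  + exact/boundary_value_scale/continuous_edge.
  + by rewrite -(cd j); exact/boundary_value_scale/continuous_edge'.
- move=> j; rewrite (_ : (fun x => _) = (fun x =>
  (omega * (1 - kap ^+ 2))%:C * c j * (edge L omega kap (a j) x)%:C)).
    exact/L2_scale/edge_L2.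
  by apply/funext => x; rewrite /graph_edge mulrA.
- move=> j; eexists; eexists; split; first exact: graph_edge_derivatives.
  apply: aeW => x _ /=; rewrite edge''E// /graph_edge /sech_potential.
  rewrite rmorphM rmorphB /=; ring.
Qed.

Lemma eigenfunction_edges kap u : 1 < kap ->
  operator_eigenspace (schroedinger_delta' L Z sech_potential) (omega * (1 - kap ^+ 2)) u ->
  exists2 c, vertex_coef kap c & graph_eq L u (graph_edge kap c).
Proof.
move=> k1 [[_ [u' [cc [d [du' bu bu' sumc]]]]] _ eqn].
have /choice[c cP] : forall j, exists z : C,
    [/\ u j = (fun x => z * (edge L omega kap (a j) x)%:C) %[ae mu in half_line L],
     cc j = z * (edge L omega kap (a j) L)%:C & d = z * (edge' L omega kap (a j) L)%:C].
  move=> j; have [v [w [[[ru iu] [rv iv] [rw iw] [ruv iuv] [rvw ivw]] E]]] := eqn j.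
  have [[ru' iu'] [rdu' idu']] := du' j.
  have ce := @continuous_edge _ L omega kap (a j).
  have ce' := @continuous_edge' _ L omega kap (a j).
  have cM (r : R) (f : R -> R) : continuous f -> continuous (fun x => r * f x).
    by move=> cf x; apply: cvgM; [exact: cvg_cst|exact: cf].
  have [|r [rE rE']] := real_eigenfunction L0 omega0 k1 (a0 j) ru rv rw ruv rvw.
    apply: aeS E => x H /H /(congr1 (@complex.Re R)).
    by rewrite ReMl raddfD raddfN /= ReMl.
  have [|i [iE iE']] := real_eigenfunction L0 omega0 k1 (a0 j) iu iv iw iuv ivw.
    apply: aeS E => x H /H /(congr1 (@complex.Im R)).
    by rewrite ImMl raddfD raddfN /= ImMl.
  have [br bi] := bu j; have [br' bi'] := bu' j.
  (* The derivative [u'] in the vertex condition and the derivative [v] in the equation are chosen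
     independently; uniqueness identifies them, so the boundary value of [u'] is that of the
     explicit solution. *)
  have wr := real_weak_derivative_unique ru' rv rdu' ruv.
  have wi := real_weak_derivative_unique iu' iv idu' iuv.
  have T (f g h : R -> R) : f = g %[ae mu in half_line L] -> g = h %[ae mu in half_line L] ->
      f = h %[ae mu in half_line L].
    by apply: aeS2 => x A B Dx; rewrite A// B.
  exists (r +i* i); split.
  - apply: aeS2 rE iE => x A B Dx; apply: eq_ReIm; rewrite ?ReMr ?ImMr.
      exact: A.
    exact: B.
  - apply: eq_ReIm; rewrite ?ReMr ?ImMr /=.
      exact: (real_boundary_value_unique (cM r _ ce) rE br).
    exact: (real_boundary_value_unique (cM i _ ce) iE bi).
  - apply: eq_ReIm; rewrite ?ReMr ?ImMr /=.
      exact: (real_boundary_value_unique (cM r _ ce') (T _ _ _ wr rE') br').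
    exact: (real_boundary_value_unique (cM i _ ce') (T _ _ _ wi iE') bi').
exists c; last by move=> j; have [] := cP j.
exists d; split; first by move=> j; have [_ _ ->] := cP j.
by rewrite -sumc; apply: eq_bigr => j _; have [_ -> _] := cP j.
Qed.

Lemma graph_edge_inj kap c c' : 1 < kap ->
  graph_eq L (graph_edge kap c) (graph_edge kap c') -> c = c'.
Proof.
move=> k1 E; apply/funext => j.
have [x Dx] := ae_half_line_ex (E j).
have e0 : (edge L omega kap (a j) x)%:C != 0.
  rewrite (inj_eq (@complexI R) _ 0) gt_eqF// edge_gt0//.
  by move: Dx; rewrite /half_line /= in_itv/= andbT => /ltW.
by rewrite /graph_edge => /(mulIf e0).
Qed.

End graph_eigenfunctions.

(** * Linear algebra of the vertex condition *)

Section coefficient_spaces.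
Context {R : realType} {N : nat}.
Notation C := R[i].
Implicit Types (E : set ('I_N -> C)) (c : 'I_N -> C).

Definition coef_dimension E (d : nat) := exists B : 'I_d -> 'I_N -> C,
  [/\ forall k, E (B k),
      forall al : 'I_d -> C, (forall j, \sum_k al k * B k j = 0) -> forall k, al k = 0 &
      forall c, E c -> exists al : 'I_d -> C, forall j, c j = \sum_k al k * B k j].

Definition vertex_condition (Z : R) (f g : 'I_N -> R) : set ('I_N -> C) :=
  [set c | exists d : C,
    (forall j, c j * (g j)%:C = d) /\ \sum_j c j * (f j)%:C = Z%:C * d].

Lemma realC_neq0 (r : R) : r != 0 -> r%:C != 0 :> C.
Proof. by move=> r0; rewrite (inj_eq (@complexI R) _ 0). Qed.

(** When no [g j] vanishes, every coefficient is recovered from the common derivative [d], and a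
    single scalar equation for [d] remains. *)
Lemma vertex_condition_regular Z f g c : (forall j, g j != 0) ->
  vertex_condition Z f g c -> exists d : C, c = (fun j => d * (g j)^-1%:C) /\
    (Z - \sum_j f j / g j)%:C * d = 0.
Proof.
move=> g0 [d [cg cs]]; exists d; have cE : c = (fun j => d * (g j)^-1%:C).
  apply/funext => j; apply: (mulIf (realC_neq0 (g0 j))).
  by rewrite cg -mulrA -rmorphM mulVf// rmorph1 mulr1.
split => //; rewrite rmorphB mulrBl -cs cE rmorph_sum mulr_suml -sumrB big1// => j _.
by rewrite rmorphM /=; ring.
Qed.

Lemma vertex_condition_trivial Z f g c : (forall j, g j != 0) ->
  \sum_j f j / g j != Z -> vertex_condition Z f g c -> c = fun=> 0.
Proof.
move=> g0 s0 /(vertex_condition_regular g0)[d [-> /eqP]].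
rewrite mulf_eq0 => /orP[|/eqP ->]; last by apply/funext => j; rewrite mul0r.
by rewrite (negbTE (realC_neq0 _))// subr_eq0 eq_sym.
Qed.

Lemma vertex_condition_line Z f g E : (0 < N)%N -> (forall j, g j != 0) ->
  \sum_j f j / g j = Z -> E `<=` vertex_condition Z f g ->
  E (fun j => (g j)^-1%:C) -> coef_dimension E 1.
Proof.
move=> N0 g0 s0 EV Eg; exists (fun _ j => (g j)^-1%:C); split => //.
  move=> al /(_ (Ordinal N0)); rewrite big_ord1 => /eqP.
  rewrite mulf_eq0 [X in _ || X](negbTE (realC_neq0 _)) ?invr_eq0// orbF => /eqP al0 k.
  by rewrite (ord1 k).
move=> c /EV/(vertex_condition_regular g0)[d [-> _]].
by exists (fun=> d) => j; rewrite big_ord1.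
Qed.

Lemma vertex_condition_inv Z f g : (forall j, g j != 0) ->
  \sum_j f j / g j = Z -> vertex_condition Z f g (fun j => (g j)^-1%:C).
Proof.
move=> g0 s0; exists 1; split.
  by move=> j; rewrite -rmorphM mulVf// rmorph1.
rewrite mulr1 -s0 rmorph_sum; apply: eq_bigr => j _.
by rewrite -rmorphM mulrC.
Qed.

Section singular.
Context (Z : R) (f g : 'I_N -> R) (S : {set 'I_N}) (f0 : R) (j0 : 'I_N).
Hypotheses (gS : forall j, (g j == 0) = (j \in S)) (fS : forall j, j \in S -> f j = f0)
  (f00 : f0 != 0) (j0S : j0 \in S).

(** One zero of [g] forces the common derivative [d] to be 0. This kills the coefficients off [S],
    and the common value [f0] on [S] can be divided out of the sum condition. *)
Lemma vertex_condition_singular c : vertex_condition Z f g c <->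
  (forall j, j \notin S -> c j = 0) /\ \sum_(j in S) c j = 0.
Proof.
split=> [[d [cg cs]]|[c0 cs]].
  have d0 : d = 0.
    have := cg j0; have := gS j0; rewrite j0S => /eqP ->.
    by rewrite mulr0 => <-.
  have c0 j : j \notin S -> c j = 0.
    move=> jS; have := cg j; rewrite d0 => /eqP; rewrite mulf_eq0.
    by rewrite [X in _ || X](negbTE (realC_neq0 _)) ?orbF ?gS// => /eqP.
  split => //; move: cs; rewrite d0 mulr0 (bigID (mem S)) /= [X in _ + X]big1 ?addr0.
    rewrite (eq_bigr (fun j => c j * f0%:C)); last by move=> j jS; rewrite fS.
    by rewrite -mulr_suml => /eqP; rewrite mulf_eq0 (negbTE (realC_neq0 f00)) orbF => /eqP.
  by move=> j jS; rewrite c0// mul0r.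
exists 0; split.
  move=> j; have [jS|jS] := boolP (j \in S); last by rewrite c0// mul0r.
  by have := gS j; rewrite jS => /eqP ->; rewrite mulr0.
rewrite mulr0 (bigID (mem S)) /= [X in _ + X]big1 ?addr0.
  rewrite (eq_bigr (fun j => c j * f0%:C)); last by move=> j jS; rewrite fS.
  by rewrite -mulr_suml cs mul0r.
by move=> j jS; rewrite c0// mul0r.
Qed.

(** A basis is given by the unit vectors of the edges of [S] other than [j0], each minus the unit
    vector of [j0]. *)
Lemma vertex_condition_singular_dimension :
  coef_dimension (vertex_condition Z f g) #|S|.-1.
Proof.
have -> : #|S|.-1 = #|S :\ j0| by rewrite (cardsD1 j0 S) j0S.
pose e (k : 'I_#|S :\ j0|) : 'I_N := enum_val k.
have eS k : e k \in S :\ j0 by exact: enum_valP.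
have ej0 k : e k != j0 by have := eS k; rewrite !inE => /andP[].
have einj : injective e by exact: enum_val_inj.
exists (fun k j => (j == e k)%:R - (j == j0)%:R); split.
- move=> k; apply/vertex_condition_singular; split.
    move=> j jS; have -> : (j == e k) = false.
      by apply: contraNF jS => /eqP ->; have := eS k; rewrite !inE => /andP[].
    have -> : (j == j0) = false by apply: contraNF jS => /eqP ->.
    by rewrite subrr.
  rewrite sumrB (bigD1 (e k)) /=; last by have := eS k; rewrite !inE => /andP[].
  rewrite eqxx big1 ?addr0; last by move=> j /andP[_ /negbTE ->].
  rewrite (bigD1 j0)//= eqxx big1 ?addr0 ?subrr//.
  by move=> j /andP[_ /negbTE ->].
- move=> al al0 k; have := al0 (e k).
  rewrite (bigD1 k) //= eqxx (negbTE (ej0 k)) subr0 mulr1 big1 ?addr0// => l lk.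
  by rewrite (inj_eq einj) eq_sym (negbTE lk) subr0 mulr0.
- move=> c /vertex_condition_singular[c0 cs]; exists (fun k => c (e k)) => j.
  have [->|jj0] := eqVneq j j0.
    rewrite (eq_bigr (fun k => - c (e k))); last first.
      by move=> k _; rewrite [j0 == _]eq_sym (negbTE (ej0 k)) sub0r mulrN1.
    rewrite sumrN; move: cs; rewrite (big_setD1 j0)//= => /eqP.
    rewrite addr_eq0 => /eqP ->; congr (- _).
    by rewrite big_enum_val.
  have [jS|jS] := boolP (j \in S); last first.
    rewrite c0// big1// => k _; rewrite subr0.
    have -> : (j == e k) = false; last by rewrite mulr0.
    by apply: contraNF jS => /eqP ->; have := eS k; rewrite !inE => /andP[].
  have jS' : j \in S :\ j0 by rewrite !inE jj0.
  have [k0 ek0] : exists k0, e k0 = j.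
    by exists (enum_rank_in jS' j); rewrite /e enum_rankK_in.
  rewrite (bigD1 k0) //= ek0 eqxx subr0 mulr1 big1 ?addr0// => k kk0.
  have -> : (j == e k) = false; last by rewrite subr0 mulr0.
  by rewrite -ek0 (inj_eq einj) eq_sym (negbTE kk0).
Qed.

End singular.

End coefficient_spaces.

(** * From coefficient spaces to the Morse index *)

Section morse_index_assembly.
Context {R : realType} {N : nat}.
Notation mu := (@lebesgue_measure R).
Notation C := R[i].
Variables (L omega : R) (a : 'I_N -> R).
Hypotheses (omega0 : 0 < omega) (a0 : forall j, 0 < a j).
Notation gedge := (graph_edge L omega a).
Notation energy kap := (omega * (1 - kap ^+ 2)).

Lemma has_dimension_graph_edge (V : set (@graph_fun R N)) (E : set ('I_N -> C)) kap d :
  1 < kap -> (forall c, E c -> V (gedge kap c)) ->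
  (forall u, V u -> exists2 c, E c & graph_eq L u (gedge kap c)) ->
  coef_dimension E d -> has_dimension L V d.
Proof.
move=> k1 EV VE [B [EB Bfree Bspan]]; exists (fun k => gedge kap (B k)).
have lE al : lincomb al (fun k => gedge kap (B k)) = gedge kap (fun j => \sum_k al k * B k j).
  apply/funext => j; apply/funext => x; rewrite /lincomb /graph_edge mulr_suml.
  by apply: eq_bigr => k _; rewrite mulrA.
split; first by move=> k; exact: EV.
  move=> al; rewrite lE => H; apply: Bfree => j.
  have : graph_eq L (gedge kap (fun j => \sum_k al k * B k j)) (gedge kap (fun=> 0)).
    by move=> i; apply: aeS (H i) => x Hx Dx; rewrite Hx// /graph_edge mul0r.
  by move=> /(graph_edge_inj omega0 a0 k1)/(congr1 (fun c => c j)).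
move=> u /VE[c /Bspan[al cE] uc]; exists al.
by rewrite lE (_ : (fun j => _) = c)//; apply/funext => j; rewrite cE.
Qed.

Lemma energy_inj : {in [pred kap : R | 1 < kap] &, injective (fun kap => energy kap)}.
Proof.
move=> x y; rewrite !inE => x1 y1 /(mulfI (lt0r_neq0 omega0)) /(addrI 1) /oppr_inj /eqP.
have x0 : 0 <= x by rewrite (le_trans ler01)// ltW.
have y0 : 0 <= y by rewrite (le_trans ler01)// ltW.
by rewrite eqrXn2// => /eqP.
Qed.

(** The list [s] may contain values with [m kap = 0], such as the pole of a side with a single edge;
    they are filtered out, since the Morse index enumerates genuine eigenvalues. *)
Lemma morse_index_coef (T : @operator R N) (E : R -> set ('I_N -> C)) (s : seq R) (m : R ->
  nat) :
  (forall kap c, 1 < kap -> E kap c -> operator_eigenspace T (energy kap) (gedge kap c)) ->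
  (forall kap u, 1 < kap -> operator_eigenspace T (energy kap) u ->
    exists2 c, E kap c & graph_eq L u (gedge kap c)) ->
  uniq s -> {in s, forall kap, 1 < kap} ->
  {in s, forall kap, coef_dimension (E kap) (m kap)} ->
  (forall kap c, 1 < kap -> kap \notin s -> E kap c -> c = fun=> 0) ->
  morse_index L T (\sum_(kap <- s) m kap).
Proof.
move=> ET TE us s1 sm s0.
pose s' := [seq kap <- s | (0 < m kap)%N].
(* Multiplicities are indexed by the eigenvalue, so the energy is inverted to recover [kap]. *)
pose root lam := Num.sqrt (1 - lam / omega).
have rootK kap : 1 < kap -> root (energy kap) = kap.
  move=> k1; rewrite /root [omega * _]mulrC mulfK ?gt_eqF// opprB addrC subrK sqrtr_sqr.
  by rewrite gtr0_norm// (lt_trans ltr01).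
have root1 lam : lam < 0 -> 1 < root lam /\ energy (root lam) = lam.
  move=> l0; have p : 1 < 1 - lam / omega by rewrite ltrDl -mulNr divr_gt0// oppr_gt0.
  split; first by rewrite /root -{1}sqrtr1 ltr_sqrt// (lt_trans ltr01).
  by rewrite /root sqr_sqrtr ?(le_trans ler01 (ltW p))//; field; rewrite gt_eqF.
have energy0 kap : 1 < kap -> energy kap < 0.
  by move=> k1; rewrite pmulr_rlt0// subr_lt0 expr_gt1// (le_trans ler01 (ltW k1)).
exists [seq energy kap | kap <- s'], (fun lam => m (root lam)); split.
- rewrite map_inj_in_uniq ?filter_uniq// => x y.
  rewrite !mem_filter => /andP[_ /s1 x1] /andP[_ /s1 y1]; exact: energy_inj.
- move=> lam; split.
    move=> /mapP[kap]; rewrite mem_filter => /andP[mk ks] ->.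
    have k1 := s1 _ ks; split; first exact: energy0.
    have [B [EB Bfree _]] := sm _ ks; pose k0 : 'I_(m kap) := Ordinal mk.
    exists (gedge kap (B k0)); first exact: ET.
    move=> H; have : graph_eq L (gedge kap (B k0)) (gedge kap (fun=> 0)).
      by move=> i; apply: aeS (H i) => x Hx Dx; rewrite Hx// /graph_edge mul0r.
    move=> /(graph_edge_inj omega0 a0 k1) B0.
    have /Bfree/(_ k0)/eqP : forall j, \sum_k (k == k0)%:R * B k j = 0.
      move=> j; rewrite (bigD1 k0)//= ?eqxx mul1r B0 add0r big1// => k /negbTE ->.
      by rewrite mul0r.
    by rewrite eqxx oner_eq0.
  move=> [/root1[r1 rE] [u uT u0]]; rewrite -rE in uT.
  have [c Ec uc] := TE _ _ r1 uT.
  have c0 : c <> fun=> 0.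
    move=> c0; apply: u0 => i; apply: aeS (uc i) => x ux Dx.
    by rewrite ux// c0 /graph_edge mul0r.
  have rs : root lam \in s.
    by apply: contrapT => /negP rs; apply: c0; exact: s0 Ec.
  apply/mapP; exists (root lam); last by rewrite rE.
  rewrite mem_filter rs andbT lt0n; apply/negP => /eqP m0.
  have := sm _ rs; rewrite m0 => -[B [_ _ /(_ _ Ec)[al cE]]].
  by apply: c0; apply/funext => j; rewrite cE big_ord0.
- move=> lam /mapP[kap]; rewrite mem_filter => /andP[mk ks] ->.
  have k1 := s1 _ ks; rewrite rootK//.
  apply: (has_dimension_graph_edge k1 _ _ (sm _ ks)) => [c|u]; [exact: ET|exact: TE].
- rewrite big_map big_filter [RHS]big_mkcond /=; apply: eq_big_seq => kap /s1 k1.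
  by rewrite rootK//; case: (m kap).
Qed.

End morse_index_assembly.

(** * Comparison of the parameters *)

Section alpha_bounds.
Context {R : realType}.
Implicit Types (n m t s : R).

Lemma lt_of_sqr (x y : R) : 0 <= y -> x ^+ 2 < y ^+ 2 -> x < y.
Proof. by move=> y0; apply: contraTT; rewrite -!leNgt => yx; nra. Qed.

Lemma le_of_sqr (x y : R) : 0 <= y -> x ^+ 2 <= y ^+ 2 -> x <= y.
Proof. by move=> y0; apply: contraTT; rewrite -!ltNge => yx; nra. Qed.

(** The larger weight [n] meets the larger reciprocal 1/t, so the sum exceeds (n + m) (1/t + 1/s) /
    2; and t s <= 1/2 gives (1/t + 1/s)^2 >= 8. *)
Lemma alpha_sqr_gt n m t s : 0 < m -> m < n -> 0 < t -> t < s -> t ^+ 2 + s ^+ 2 = 1 ->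
  2 * (n + m) ^+ 2 < (n / t + m / s) ^+ 2.
Proof.
move=> m0 mn t0 ts st; have s0 := lt_trans t0 ts.
have ti0 : 0 < t^-1 by rewrite invr_gt0.
have si0 : 0 < s^-1 by rewrite invr_gt0.
have tsi : s^-1 < t^-1 by rewrite ltf_pV2.
have E : n / t + m / s = (n + m) * (t^-1 + s^-1) / 2 + (n - m) * (t^-1 - s^-1) / 2 by field;
  rewrite !gt_eqF.
have X : (n + m) * (t^-1 + s^-1) / 2 < n / t + m / s.
  rewrite E ltrDl divr_gt0// mulr_gt0 ?subr_gt0//.
have Y : 8 <= (t^-1 + s^-1) ^+ 2.
  have -> : (t^-1 + s^-1) ^+ 2 = (t ^+ 2 + s ^+ 2 + 2 * t * s) / (t * s) ^+ 2 by field;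
    rewrite !gt_eqF.
  have p0 : 0 < t * s by rewrite mulr_gt0.
  have p1 : 2 * (t * s) <= 1 by rewrite -[X in _ <= X]st; have := sqr_ge0 (t - s); lra.
  rewrite st ler_pdivlMr ?exprn_gt0// -mulrA; move: (t * s) p0 p1 => p p0 p1; nra.
have S0 : 0 < t^-1 + s^-1 by rewrite addr_gt0.
have M0 : 0 < n + m by lra.
apply: (@le_lt_trans _ _ (((n + m) * (t^-1 + s^-1) / 2) ^+ 2)).
  have -> : ((n + m) * (t^-1 + s^-1) / 2) ^+ 2 = (n + m) ^+ 2 * ((t^-1 + s^-1) ^+ 2 / 4)
    by field; rewrite !gt_eqF.
  by rewrite mulrC ler_pM2l ?exprn_gt0//; lra.
have B0 : 0 < (n + m) * (t^-1 + s^-1) / 2 by rewrite divr_gt0// mulr_gt0.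
by rewrite ltrXn2r// ltW.
Qed.

(** The last hypothesis bounds [m] by n s^3 / t^3. At this extreme value the claim reduces to sqrt 2
    (t^3 + s^3) >= 1, the power mean inequality between the exponents 2 and 3. *)
Lemma alpha_sqr_lt n m t s : 0 < m -> 0 < n -> 0 < s -> s < t -> t ^+ 2 + s ^+ 2 = 1 ->
  m * t ^+ 3 < n * s ^+ 3 -> (n / t + m / s) ^+ 2 < 2 * (n + m) ^+ 2.
Proof.
move=> m0 n0 s0 st ts1 H; have t0 := lt_trans s0 st.
pose q : R := Num.sqrt 2.
have q0 : 0 < q by rewrite sqrtr_gt0.
have q2 : q ^+ 2 = 2 by rewrite sqr_sqrtr.
have qs : q * s < 1.
  apply: lt_of_sqr => //; rewrite exprMn q2 expr1n.
  rewrite -[X in _ < X]ts1; nra.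
have K : 1 <= q * (t ^+ 3 + s ^+ 3).
  have c0 : 0 < t ^+ 3 + s ^+ 3 by rewrite addr_gt0 ?exprn_gt0.
  apply: le_of_sqr; first by rewrite mulr_ge0 ?ltW.
  rewrite exprMn q2 expr1n.
  rewrite -[X in X <= _](expr1n R 3) -[X in X ^+ 3 <= _]ts1 -subr_ge0.
  have -> : 2 * (t ^+ 3 + s ^+ 3) ^+ 2 - (t ^+ 2 + s ^+ 2) ^+ 3 =
    (t - s) ^+ 2 * (t ^+ 4 + 2 * t ^+ 3 * s + 2 * t * s ^+ 3 + s ^+ 4) by ring.
  by rewrite mulr_ge0 ?sqr_ge0// !addr_ge0 ?mulr_ge0 ?exprn_ge0 ?ltW.
have D : n / t + m / s < q * (n + m).
  rewrite -subr_gt0 -(pmulr_rgt0 (x := t ^+ 3 * s)); last by rewrite mulr_gt0 ?exprn_gt0.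
  have -> : t ^+ 3 * s * (q * (n + m) - (n / t + m / s)) =
     s * n * (q * t ^+ 3 - t ^+ 2) - m * t ^+ 3 * (1 - q * s) by field; rewrite !gt_eqF.
  have A : m * t ^+ 3 * (1 - q * s) < n * s ^+ 3 * (1 - q * s) by rewrite ltr_pM2r ?subr_gt0.
  have B : 0 <= s * n * (q * (t ^+ 3 + s ^+ 3) - 1) by apply: mulr_ge0;
    [rewrite mulr_ge0 ?ltW|rewrite subr_ge0].
  have E : s * n * (q * t ^+ 3 - t ^+ 2) - n * s ^+ 3 * (1 - q * s) =
    s * n * (q * (t ^+ 3 + s ^+ 3) - (t ^+ 2 + s ^+ 2)) by ring.
  rewrite ts1 in E; lra.
have P : 0 < n / t + m / s by rewrite addr_gt0 ?divr_gt0.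
by rewrite -q2 -exprMn ltrXn2r// ltW.
Qed.

(** The conclusion says that [alpha] has negative derivative at [t]; this is the form in which
    [t < t_star N n] is used from here on. *)
Lemma t_star_lt (N n : nat) (t : R) : (0 < n < N)%N -> 0 < t < t_star N n ->
  t < 1 /\ (N - n)%:R * t ^+ 3 < n%:R * Num.sqrt (1 - t ^+ 2) ^+ 3.
Proof.
move=> /andP[n0 nN] /andP[t0]; rewrite /t_star.
set A := n%:R `^ (2 / 3); set B := (N - n)%:R `^ (2 / 3) => tA.
have nR : 0 < n%:R :> R by rewrite ltr0n.
have mR : 0 < (N - n)%:R :> R by rewrite ltr0n subn_gt0.
have A0 : 0 < A by rewrite powR_gt0.
have B0 : 0 < B by rewrite powR_gt0.
have cube (x : R) : 0 < x -> (x `^ (2 / 3)) ^+ 3 = x ^+ 2.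
  move=> x0; rewrite -powR_mulrn ?powR_ge0// -powRrM -[2 / 3 * 3%:R]mulrA mulVf// mulr1.
  by rewrite powR_mulrn// ltW.
have t2 : t ^+ 2 * (A + B) < A.
  rewrite -ltr_pdivlMr ?addr_gt0//.
  rewrite -[ltRHS]sqr_sqrtr; last by rewrite divr_ge0 ?addr_ge0 ?ltW.
  by rewrite ltrXn2r// ltW.
have t1 : t < 1.
  by apply: lt_of_sqr => //; rewrite expr1n; nra.
split => //; set s := Num.sqrt _.
have s2 : s ^+ 2 = 1 - t ^+ 2 by rewrite sqr_sqrtr// subr_ge0; nra.
have s0 : 0 < s by rewrite sqrtr_gt0 subr_gt0; nra.
have L : t ^+ 2 * B < s ^+ 2 * A by rewrite s2; lra.
(* Cubing removes the exponent 2/3 and leaves squares on both sides. *)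
have : (t ^+ 2 * B) ^+ 3 < (s ^+ 2 * A) ^+ 3.
  by rewrite ltrXn2r// mulr_ge0 ?sqr_ge0 ?ltW.
have -> : (t ^+ 2 * B) ^+ 3 = ((N - n)%:R * t ^+ 3) ^+ 2.
  by rewrite (exprMn _ (t ^+ 2)) [B ^+ 3]cube//; ring.
have -> : (s ^+ 2 * A) ^+ 3 = (n%:R * s ^+ 3) ^+ 2.
  by rewrite (exprMn _ (s ^+ 2)) [A ^+ 3]cube//; ring.
by apply: lt_of_sqr; rewrite mulr_ge0 ?exprn_ge0 ?ltW.
Qed.

End alpha_bounds.

(** * Morse indices of a star with two kinds of edges *)

Section two_sided_star.
Context {R : realType}.
Notation mu := (@lebesgue_measure R).
Notation C := R[i].
Variables (L Z omega t1 tN : R) (N n : nat).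
Hypotheses (L0 : 0 <= L) (omega0 : 0 < omega) (n0 : (0 < n)%N) (nN : (n < N)%N)
  (t101 : 0 < t1 < 1) (tN01 : 0 < tN < 1).

Let k := Num.sqrt omega.
Let t (b : bool) := if b then t1 else tN.
Let a (j : 'I_N) := if (j < n)%N then artanh t1 else artanh tN.
Let sides (j : 'I_N) := (j < n)%N.

Let k0 : 0 < k. Proof. by rewrite sqrtr_gt0. Qed.

Let t01 b : 0 < t b < 1. Proof. by case: b. Qed.

Let a0 j : 0 < a j.
Proof. by rewrite /a; case: ifP => _; exact: artanh_gt0. Qed.

Let tanh_a j : tanh (a j) = t (sides j).
Proof.
have m1 x : 0 < x < 1 -> -1 < x < 1 by move=> /andP[x0 ->]; rewrite (lt_trans _ x0)// oppr_lt0.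
by rewrite /a /t /sides; case: ifP => _; rewrite tanh_artanh// m1.
Qed.

Lemma card_side b : #|[set j : 'I_N | sides j == b]%SET| = if b then n else (N - n)%N.
Proof.
have cT : #|[set j : 'I_N | sides j]%SET| = n.
  have <- : (\sum_(j < N | (j < n)%N) 1 = n)%N.
    by rewrite (big_ord_narrow (ltnW nN)) sum1_card card_ord.
  by rewrite -sum1_card; apply: eq_bigl => j; rewrite inE.
case: b.
  by rewrite -[RHS]cT; apply: eq_card => j; rewrite !inE eqb_id.
have := cardsC [set j : 'I_N | sides j]%SET; rewrite cT card_ord => H.
rewrite -[in RHS]H addKn; apply: eq_card => j.
by rewrite !inE eqbF_neg.
Qed.

Lemma sum_sides (x y : R) :
  \sum_(j < N) (if sides j then x else y) = n%:R * x + (N - n)%:R * y.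
Proof.
rewrite (bigID sides) /=; congr (_ + _).
  rewrite (eq_bigr (fun=> x)); last by move=> j ->.
  rewrite sumr_const -[n in RHS](card_side true) mulr_natl; congr (_ *+ _).
  by apply: eq_card => j; rewrite [RHS]inE eqb_id.
rewrite (eq_bigr (fun=> y)); last by move=> j /negbTE ->.
rewrite sumr_const -[(N - n)%N in RHS](card_side false) mulr_natl; congr (_ *+ _).
by apply: eq_card => j; rewrite [RHS]inE eqbF_neg.
Qed.

Let f kap (j : 'I_N) := edge L omega kap (a j) L.
Let g kap (j : 'I_N) := edge' L omega kap (a j) L.
Let S kap := jost_sum n%:R (N - n)%:R t1 tN (- Z * k) kap.

Definition side_invariant : set ('I_N -> C) :=
  [set c | forall i j, sides i = sides j -> c i = c j].

Let E kap := vertex_coef L Z omega a kap.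
Let E' kap := E kap `&` side_invariant.

Let fE kap j : f kap j = expR (- kap * a j) * jost_poly kap (t (sides j)).
Proof. by rewrite /f edge_vertex tanh_a. Qed.

Let gE kap j : g kap j = k * (expR (- kap * a j) * jost_poly' kap (t (sides j))).
Proof. by rewrite /g edge'_vertex tanh_a. Qed.

Let g_eq0 kap j : (g kap j == 0) = (jost_poly' kap (t (sides j)) == 0).
Proof. by rewrite gE mulf_eq0 gt_eqF//= mulf_eq0 gt_eqF// expR_gt0. Qed.

Let f_gt0 kap j : 1 < kap -> 0 < f kap j.
Proof.
by move=> k1; apply: edge_gt0.
Qed.

(** The factor exp (- kap a_j) cancels in [f / g], so only the side of an edge matters. The vertex
    equation for [Z] becomes the vanishing of [S]. *)
Let sum_fg kap : \sum_j f kap j / g kap j = Z + k^-1 * S kap.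
Proof.
have -> : \sum_j f kap j / g kap j =
   \sum_(j < N) (if sides j then k^-1 * jost_ratio kap t1 else k^-1 * jost_ratio kap tN).
  have key (e p q : R) : e != 0 -> e * p / (k * (e * q)) = k^-1 * (p / q).
    move=> e0; rewrite !invfM -[RHS]mulr1 -(mulfV e0); ring.
  apply: eq_bigr => j _; rewrite fE gE key; last by rewrite gt_eqF// expR_gt0.
  by rewrite /jost_ratio /t; case: ifP.
rewrite sum_sides /S /jost_sum; field.
by rewrite gt_eqF.
Qed.

Let a_side i j : sides i = sides j -> a i = a j.
Proof. by rewrite /sides /a => ->. Qed.

Let g_side kap i j : sides i = sides j -> g kap i = g kap j.
Proof. by rewrite /g => /a_side ->. Qed.

Let regular kap := jost_poly' kap t1 != 0 /\ jost_poly' kap tN != 0.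

Let g_neq0 kap : regular kap -> forall j, g kap j != 0.
Proof. by move=> [q1 qN] j; rewrite g_eq0 /t; case: ifP. Qed.

Let regular_trivial kap c : regular kap -> S kap != 0 -> E kap c -> c = fun=> 0.
Proof.
move=> r s0; apply: (@vertex_condition_trivial _ _ Z (f kap) (g kap)); first exact: g_neq0.
by rewrite sum_fg -subr_eq0 addrAC subrr add0r mulf_neq0// invr_neq0// gt_eqF.
Qed.

Let regular_root kap : regular kap -> S kap = 0 ->
  coef_dimension (E kap) 1 /\ coef_dimension (E' kap) 1.
Proof.
move=> r s0; have g0 := g_neq0 r.
have sZ : \sum_j f kap j / g kap j = Z by rewrite sum_fg s0 mulr0 addr0.
have inv : vertex_condition Z (f kap) (g kap) (fun j => (g kap j)^-1%:C).
  exact: vertex_condition_inv.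
have N0 : (0 < N)%N by exact: leq_trans nN.
split; apply: (@vertex_condition_line _ _ Z (f kap) (g kap)) => //.
  by move=> c [].
by split => // i j /g_side ->.
Qed.

Let singular b kap : 1 < kap -> jost_poly' kap (t b) = 0 -> jost_poly' kap (t (~~ b)) != 0 ->
  coef_dimension (E kap) (if b then n else (N - n)%N).-1 /\
  forall c, E' kap c -> c = fun=> 0.
Proof.
move=> k1 qb qnb.
have [j0 j0b] : exists j0 : 'I_N, sides j0 = b.
  case: b {qb qnb}; first by exists (Ordinal (leq_trans n0 (ltnW nN))).
  by exists (Ordinal nN); rewrite /sides /= ltnn.
pose T := [set j : 'I_N | sides j == b]%SET.
have gT j : (g kap j == 0) = (j \in T).
  rewrite g_eq0 inE; have [->|sb] := eqVneq (sides j) b; first by rewrite qb eqxx.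
  apply/negbTE; have -> // : sides j = ~~ b by case: (sides j) b sb {qb qnb j0b T} => -[].
have fT j : j \in T -> f kap j = f kap j0.
  by rewrite inE => /eqP jb; rewrite /f (@a_side j j0)// jb.
have f0 : f kap j0 != 0 by rewrite gt_eqF// f_gt0.
have j0T : j0 \in T by rewrite inE j0b.
split.
  by have := vertex_condition_singular_dimension Z gT fT f0 j0T; rewrite card_side.
(* On the singular side the coefficients are constant by symmetry and sum to 0, hence vanish. *)
move=> c [Ec cinv]; have /(vertex_condition_singular Z gT fT f0 j0T)[c0 cs] := Ec.
apply/funext => j; have [jT|] := boolP (j \in T); last exact: c0.
have cE i : i \in T -> c i = c j.
  by move=> iT; apply: cinv; move: iT jT; rewrite !inE => /eqP -> /eqP ->.
move: cs; rewrite (eq_bigr (fun=> c j))// sumr_const => /eqP.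
rewrite mulrn_eq0 => /orP[|/eqP //].
by rewrite cards_eq0 => /eqP T0; move: j0T; rewrite T0 inE.
Qed.

Let T := schroedinger_delta' L Z (sech_potential L omega a).
Let T' := restriction T (X_mean L n).

Let T_edge kap c : 1 < kap -> E kap c ->
  operator_eigenspace T (omega * (1 - kap ^+ 2)) (graph_edge L omega a kap c).
Proof. by move=> k1; exact: vertex_coef_eigenfunction. Qed.

Let edge_T kap u : 1 < kap -> operator_eigenspace T (omega * (1 - kap ^+ 2)) u ->
  exists2 c, E kap c & graph_eq L u (graph_edge L omega a kap c).
Proof. by move=> k1; exact: eigenfunction_edges. Qed.

Let T'_edge kap c : 1 < kap -> E' kap c ->
  operator_eigenspace T' (omega * (1 - kap ^+ 2)) (graph_edge L omega a kap c).
Proof.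
move=> k1 [Ec cinv]; split; last exact: T_edge.
split.
  by move=> j; exact/L2_scale/edge_L2.
move=> i j ij; apply: aeW => x _.
by rewrite /graph_edge (cinv i j)// (@a_side i j).
Qed.

Let edge_T' kap u : 1 < kap -> operator_eigenspace T' (omega * (1 - kap ^+ 2)) u ->
  exists2 c, E' kap c & graph_eq L u (graph_edge L omega a kap c).
Proof.
move=> k1 [[_ um] /(edge_T k1)[c Ec uc]]; exists c => //; split => // i j ij.
(* The almost everywhere equalities are combined to hold at one common point, where the nonzero edge
   function can be cancelled. *)
have := aeS2 (fun x A B Dx => conj (A Dx) (B Dx)) (uc i) (uc j).
move=> /(aeS2 (fun x A B Dx =>
  conj (A Dx) (B Dx)) (um i j ij)) /ae_half_line_ex[x Dx [uu [ui uj]]].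
have e0 : (edge L omega kap (a j) x)%:C != 0.
  rewrite (inj_eq (@complexI R) _ 0) gt_eqF// edge_gt0//.
  by move: Dx; rewrite /half_line /= in_itv/= andbT => /ltW.
apply: (mulIf e0); move: uu; rewrite ui uj /graph_edge.
by rewrite (@a_side i j).
Qed.

(* The pole r is the value of kap for which the edges of side b have a Neumann
   eigenvalue; l lists the solutions of the vertex equation. *)
Lemma morse_index_with_pole b r (l : seq R) : 1 < r -> jost_poly' r (t b) = 0 ->
  (forall kap, 1 < kap -> jost_poly' kap (t (~~ b)) != 0) ->
  (forall kap, 1 < kap -> kap != r -> jost_poly' kap (t b) != 0) ->
  uniq (r :: l) -> (forall kap, kap \in l -> 1 < kap /\ S kap = 0) ->
  (forall kap, 1 < kap -> kap != r -> S kap = 0 -> kap \in l) ->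
  morse_index L T ((if b then n else (N - n)%N).-1 + size l) /\ morse_index L T' (size l).
Proof.
move=> r1 qr qnb qb /= /andP[rl ul] lS Sl.
have reg kap : 1 < kap -> kap != r -> regular kap.
  by move=> k1 kr; move: (qb _ k1 kr) (qnb _ k1); rewrite /t /regular; case: (b).
have ne kap : kap \in l -> kap != r by move=> kl; apply: contraNneq rl => <-.
have line kap : kap \in l -> coef_dimension (E kap) 1 /\ coef_dimension (E' kap) 1.
  by move=> kl; have [k1 s0] := lS _ kl; apply: regular_root => //; apply: reg => //; exact: ne.
have [d2 d2'] := singular r1 qr (qnb _ r1).
have triv kap c : 1 < kap -> kap != r -> kap \notin l -> E kap c -> c = fun=> 0.
  move=> k1 kr kl; apply: regular_trivial; first exact: reg.
  by apply: contraNneq kl => /(Sl _ k1 kr).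
have sizeE : size l = (\sum_(kap <- l) 1)%N by rewrite sum1_size.
split.
  pose m kap := if kap == r then (if b then n else (N - n)%N).-1 else 1%N.
  have -> : ((if b then n else (N - n)%N).-1 + size l)%N = (\sum_(kap <- r :: l) m kap)%N.
    rewrite big_cons /m eqxx sizeE; congr (_ + _)%N.
    by apply: eq_big_seq => kap /ne/negbTE ->.
  apply: (morse_index_coef omega0 a0 T_edge edge_T).
  - by rewrite /= rl.
  - by move=> kap; rewrite inE => /predU1P[->//|/lS[]].
  - move=> kap; rewrite inE /m => /predU1P[->|kl]; first by rewrite eqxx.
    by rewrite (negbTE (ne _ kl)); have [] := line _ kl.
  - by move=> kap c k1; rewrite inE negb_or => /andP[kr kl]; exact: triv.
rewrite sizeE; apply: (morse_index_coef omega0 a0 T'_edge edge_T') => //.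
- by move=> kap /lS[].
- by move=> kap /line[].
- move=> kap c k1 kl E'c; have [kr|kr] := eqVneq kap r.
    by apply: d2'; rewrite -kr.
  by case: E'c => Ec _; apply: (triv kap).
Qed.

(** Meant for t1 = tN, where the zero of [q] at [kap = 1] has energy 0 and does not count. *)
Lemma morse_index_without_pole (l : seq R) : (forall kap, 1 < kap -> regular kap) ->
  uniq l -> (forall kap, kap \in l -> 1 < kap /\ S kap = 0) ->
  (forall kap, 1 < kap -> S kap = 0 -> kap \in l) ->
  morse_index L T (size l) /\ morse_index L T' (size l).
Proof.
move=> reg ul lS Sl.
have line kap : kap \in l -> coef_dimension (E kap) 1 /\ coef_dimension (E' kap) 1.
  by move=> kl; have [k1 s0] := lS _ kl; apply: regular_root => //; exact: reg.
have triv kap c : 1 < kap -> kap \notin l -> E kap c -> c = fun=> 0.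
  move=> k1 kl; apply: regular_trivial; first exact: reg.
  by apply: contraNneq kl => /(Sl _ k1).
have sizeE : size l = (\sum_(kap <- l) 1)%N by rewrite sum1_size.
rewrite sizeE; split.
  apply: (morse_index_coef omega0 a0 T_edge edge_T) => //.
    by move=> kap /lS[].
  by move=> kap /line[].
apply: (morse_index_coef omega0 a0 T'_edge edge_T') => //.
- by move=> kap /lS[].
- by move=> kap /line[].
- by move=> kap c k1 kl [Ec _]; apply: (triv kap).
Qed.

End two_sided_star.

(** * Position of the roots relative to the pole *)

Section pole_side.
Context {R : realType}.
Implicit Types (t s : R).

Lemma jost_sumC (a b t s alp x : R) : jost_sum a b t s alp x = jost_sum b a s t alp x.
Proof. by rewrite /jost_sum [X in X + _]addrC. Qed.

(* A Neumann eigenvalue kap > 1 exists on the edges with 2 t ^+ 2 < 1 only, and the value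
   of the sum at kap = 1 decides whether it has a root to the left of that pole. *)
Lemma vertex_equation_pole (a b t s alp : R) : 0 < t < 1 -> 0 < s < 1 -> 0 < a -> 0 < b ->
  0 < alp -> 2 * t ^+ 2 < 1 -> 1 < 2 * s ^+ 2 ->
  exists r k : R, [/\ 1 < r < k, jost_poly' r t = 0, jost_sum a b t s alp k = 0,
    (forall x, 1 < x -> jost_poly' x s != 0 /\ (x != r -> jost_poly' x t != 0)) &
    (0 < jost_sum a b t s alp 1 ->
        forall x, 1 < x -> x != r -> jost_sum a b t s alp x = 0 -> x = k) /\
     (jost_sum a b t s alp 1 < 0 -> exists k' : R, [/\ 1 < k' < r, jost_sum a b t s alp k' = 0 &
        forall x, 1 < x -> x != r -> jost_sum a b t s alp x = 0 -> x = k \/ x = k'])].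
Proof.
move=> t01 s01 a0 b0 l0 t2 s2.
have [r [r1 qr qlt qgt]] := jost_poly'_root t01 t2.
have qs1 : jost_poly' 1 s < 0.
  by rewrite jost_poly'_1 pmulr_rlt0 ?subr_lt0// mulr_gt0// addr_gt0//; case/andP: s01.
have qs x : 1 <= x -> jost_poly' x s < 0.
  rewrite le_eqVlt => /predU1P[<-//|x1].
  by apply: (jost_poly'_lt0 s01 (lexx _) x1); exact: ltW.
have [k [rk sk kE]] := jost_sum_root_right t01 s01 a0 b0 l0 (ltW r1) qr (qs _ (ltW r1)).
exists r, k; split => //; first by rewrite r1.
- move=> x x1; split; first by rewrite lt_eqF// qs// ltW.
  rewrite neq_lt => /orP[xr|rx]; last by rewrite lt_eqF// qgt.
  by rewrite gt_eqF// qlt// (ltW x1).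
split=> [S1 x x1|S1].
  rewrite neq_lt => /orP[xr|rx] sx; last exact: kE.
  have := jost_sum_noroot_left t01 s01 a0 b0 qlt qs S1 (x := x).
  by rewrite x1 xr sx eqxx => /(_ isT).
have [k' [k'r sk' k'E]] := jost_sum_root_left t01 s01 a0 b0 r1 qr qlt qs S1.
exists k'; split => // x x1; rewrite neq_lt => /orP[xr|rx] sx.
  by right; apply: k'E; rewrite ?x1.
by left; exact: kE.
Qed.

End pole_side.

(** Left of its minimiser n / t + m / s decreases in [t], and its square is 2 (n + m)^2 at t = s;
    the three implications express this without calculus. *)
Lemma alpha_sqr_compare (R : realType) (n m t s : R) : 0 < m -> m < n -> 0 < t -> 0 < s ->
  s ^+ 2 = 1 - t ^+ 2 -> m * t ^+ 3 < n * s ^+ 3 ->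
  [/\ 2 * t ^+ 2 < 1 -> 2 * (n + m) ^+ 2 < (n / t + m / s) ^+ 2,
      1 < 2 * t ^+ 2 -> (n / t + m / s) ^+ 2 < 2 * (n + m) ^+ 2 &
      2 * t ^+ 2 = 1 -> (n / t + m / s) ^+ 2 = 2 * (n + m) ^+ 2].
Proof.
move=> m0 mn t0 s0 s2 H; have ts1 : t ^+ 2 + s ^+ 2 = 1 by rewrite s2; ring.
split=> t2.
- by apply: alpha_sqr_gt => //; apply: lt_of_sqr; [exact: ltW|lra].
- by apply: alpha_sqr_lt => //; [exact: lt_trans mn|apply: lt_of_sqr; [exact: ltW|lra]].
- have -> : s = t by apply/le_anti/andP; split; apply: le_of_sqr;
  rewrite ?(ltW t0) ?(ltW s0)//; lra.
  have -> : n / t + m / t = (n + m) / t by rewrite mulrDl.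
  have t2' : t ^+ 2 = 2^-1 by lra.
  by rewrite expr_div_n t2' invrK mulrC.
Qed.

Theorem theorem5p3 (R : realType) (L Z omega t1 : R) (N n : nat)
  (L_ge0 : 0 <= L) (Z_lt0 : Z < 0) (N_ge2 : (2 <= N)%N)
  (n_ge1 : (1 <= n)%N) (n_leN1 : (n <= N - 1)%N)
  (omega_gt : omega_star N n Z < omega)
  (t1_in : 0 < t1 < t_star N n)
  (alpha_t1 : alpha N n t1 = - Z * Num.sqrt omega) :
  [/\ (2 * n <= N)%N \/
        ((N < 2 * n)%N /\ 2 * N%:R ^+ 2 / Z ^+ 2 < omega) ->
        morse_index L (@L_plus R N n L Z omega t1) n /\
        morse_index L (restriction (@L_plus R N n L Z omega t1)
                                   (X_mean L n)) 1,
      (N < 2 * n)%N /\ omega < 2 * N%:R ^+ 2 / Z ^+ 2 ->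
        morse_index L (@L_plus R N n L Z omega t1) (N - n + 1)%N /\
        morse_index L (restriction (@L_plus R N n L Z omega t1)
                                   (X_mean L n)) 2
    & (N < 2 * n)%N /\ omega = 2 * N%:R ^+ 2 / Z ^+ 2 ->
        morse_index L (@L_plus R N n L Z omega t1) 1 /\
        morse_index L (restriction (@L_plus R N n L Z omega t1)
                                   (X_mean L n)) 1].
Proof.
have nN : (n < N)%N by rewrite (leq_ltn_trans n_leN1)// subn1 ltn_predL (leq_trans _ N_ge2).
have nN' : (0 < n < N)%N by rewrite n_ge1.
have [t1_lt1 H] := t_star_lt nN' t1_in; have /andP[t10 _] := t1_in.
set tN := Num.sqrt (1 - t1 ^+ 2) in H.
have tN2 : tN ^+ 2 = 1 - t1 ^+ 2 by rewrite sqr_sqrtr// subr_ge0; nra.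
have tN0 : 0 < tN by rewrite sqrtr_gt0 subr_gt0; nra.
have t101 : 0 < t1 < 1 by rewrite t10.
have tN01 : 0 < tN < 1 by rewrite tN0 /=; apply: lt_of_sqr => //; rewrite tN2 expr1n; nra.
have omega0 : 0 < omega by apply: le_lt_trans omega_gt; rewrite divr_ge0 ?sqr_ge0.
have nR : 0 < n%:R :> R by rewrite ltr0n.
have mR : 0 < (N - n)%:R :> R by rewrite ltr0n subn_gt0.
have nmN : n%:R + (N - n)%:R = N%:R :> R by rewrite -natrD subnKC// ltnW.
have aE : n%:R / t1 + (N - n)%:R / tN = - Z * Num.sqrt omega by [].
have al0 : 0 < - Z * Num.sqrt omega by rewrite mulr_gt0 ?oppr_gt0 ?sqrtr_gt0.
have al2 : (- Z * Num.sqrt omega) ^+ 2 = Z ^+ 2 * omega.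
  by rewrite exprMn sqrrN sqr_sqrtr// ltW.
have Z2 : 0 < Z ^+ 2 by rewrite exprn_even_gt0//= lt_eqF.
have num0 : 0 < n%:R * tN ^+ 3 - (N - n)%:R * t1 ^+ 3 by rewrite subr_gt0.
(* As alpha(t1)^2 = Z^2 omega, comparing t1^2 with 1/2 amounts to comparing omega with the
   threshold. The implications form a trichotomy, so each can be reversed by excluding the other
   two. *)
have cmp : (N < 2 * n)%N -> [/\ 2 * t1 ^+ 2 < 1 -> 2 * N%:R ^+ 2 / Z ^+ 2 < omega,
    1 < 2 * t1 ^+ 2 -> omega < 2 * N%:R ^+ 2 / Z ^+ 2 &
    2 * t1 ^+ 2 = 1 -> omega = 2 * N%:R ^+ 2 / Z ^+ 2].
  move=> Nn; have mn : (N - n)%:R < n%:R :> R.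
    by rewrite ltr_nat (ltn_subLR _ (ltnW nN)) addnn -mul2n.
  have [c1 c2 c3] := alpha_sqr_compare mR mn t10 tN0 tN2 H.
  rewrite aE al2 nmN in c1 c2 c3; split => t2.
  - by rewrite ltr_pdivrMr// [ltRHS]mulrC; exact: c1.
  - by rewrite ltr_pdivlMr// [ltLHS]mulrC; exact: c2.
  - by rewrite -(c3 t2) [Z ^+ 2 * _]mulrC mulfK// gt_eqF.
(* If [tN <= t1], then [H] would force N - n < n. *)
have small_t1 : (2 * n <= N)%N -> 2 * t1 ^+ 2 < 1.
  move=> nN2; rewrite ltNge; apply/negP => t2.
  have tt : tN <= t1 by apply: le_of_sqr; [exact: ltW|rewrite tN2; lra].
  have t3 : tN ^+ 3 <= t1 ^+ 3 by rewrite lerXn2r// nnegrE ltW.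
  have nm : n%:R <= (N - n)%:R :> R by rewrite ler_nat (leq_subRL _ (ltnW nN)) addnn -mul2n.
  have t30 : 0 < t1 ^+ 3 by rewrite exprn_gt0.
  have : n%:R * tN ^+ 3 <= (N - n)%:R * t1 ^+ 3.
    by rewrite ler_pM// ?ler0n// exprn_ge0// ltW.
  by rewrite leNgt H.
have qtrue := @morse_index_with_pole R L Z omega t1 tN N n L_ge0 omega0 n_ge1 nN t101 tN01 true.
have qfalse := @morse_index_with_pole R L Z omega t1 tN N n L_ge0 omega0 n_ge1 nN t101 tN01
  false.
have qnone := @morse_index_without_pole R L Z omega t1 tN N n L_ge0 omega0 nN t101 tN01.
split.
(* The pole belongs to the [n] edges with t1, and [H] makes the sum positive at [kap = 1], so there
   is no root to the left of the pole. *)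
- move=> hyp; have t2 : 2 * t1 ^+ 2 < 1.
    case: hyp => [/small_t1//|[Nn Zom]]; have [_ c2 c3] := cmp Nn.
    rewrite ltNge le_eqVlt; apply/negP => /predU1P[/esym/c3 E|/c2 E].
      by move: Zom; rewrite [X in _ < X]E ltxx.
    by have := lt_trans Zom E; rewrite ltxx.
  have s2 : 1 < 2 * tN ^+ 2 by rewrite tN2; lra.
  have [r [k [/andP[r1 rk] qr sk qq [kE _]]]] := vertex_equation_pole t101 tN01 nR mR al0 t2 s2.
  have S1 : 0 < jost_sum n%:R (N - n)%:R t1 tN (- Z * Num.sqrt omega) 1.
    rewrite -aE jost_sum_1// ?(lt_eqF t2)// divr_gt0// !mulr_gt0// subr_gt0//.
  have [|||||T1 T2] := qtrue r [:: k] r1 qr.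
  + by move=> x /qq[].
  + by move=> x /qq[].
  + by rewrite /= inE lt_eqF.
  + by move=> x; rewrite inE => /eqP ->; rewrite (lt_trans r1 rk).
  + by move=> x x1 xr sx; rewrite inE (kE S1 x).
  by rewrite addn1 prednK in T1.
(* The two sides exchange roles: the pole belongs to the N - n edges with tN, and the same [H] now
   makes the sum negative at [kap = 1], which adds a root between 1 and the pole. *)
- move=> [Nn Zom]; have [c1 _ c3] := cmp Nn.
  have t2 : 1 < 2 * t1 ^+ 2.
    rewrite ltNge le_eqVlt; apply/negP => /predU1P[/c3 E|/c1 E].
      by move: Zom; rewrite [X in X < _]E ltxx.
    by have := lt_trans Zom E; rewrite ltxx.
  have s2 : 2 * tN ^+ 2 < 1 by rewrite tN2; lra.
  have [r [k [/andP[r1 rk] qr sk qq [_ kE]]]] := vertex_equation_pole tN01 t101 mR nR al0 s2 t2.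
  have [|k' [/andP[k'1 k'r] sk' kk']] := kE.
    rewrite -aE [n%:R / t1 + _]addrC jost_sum_1//; [|by rewrite tN2; ring|by rewrite lt_eqF].
    rewrite pmulr_llt0; first by rewrite subr_lt0.
    by rewrite invr_gt0 !mulr_gt0// subr_gt0.
  have [|||||T1 T2] := qfalse r [:: k'; k] r1 qr.
  + by move=> x /qq[].
  + by move=> x /qq[].
  + by rewrite /= !inE negb_or (gt_eqF k'r) (lt_eqF rk) (lt_eqF (lt_trans k'r rk)).
  + by move=> x; rewrite !inE => /orP[] /eqP ->; rewrite jost_sumC ?k'1 ?(lt_trans r1 rk).
  + by move=> x x1 xr; rewrite jost_sumC !inE => /(kk' x x1 xr)[] ->; rewrite eqxx ?orbT.
  by rewrite addn2 prednK ?subn_gt0// -addn1 in T1.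
(* At the threshold tN = t1, both denominators coincide and are negative for all [kap > 1]; the one
   root gives a line that lies in X_mean. *)
- move=> [Nn Zom]; have [c1 c2 _] := cmp Nn.
  have t2 : 2 * t1 ^+ 2 = 1.
    case: (ltgtP (2 * t1 ^+ 2) 1) => [/c1 E|/c2 E|//].
      by move: E; rewrite [X in _ < X]Zom ltxx.
    by move: E; rewrite [X in X < _]Zom ltxx.
  have tE : tN = t1.
    by apply/le_anti/andP; split; apply: le_of_sqr; rewrite ?(ltW t10) ?(ltW tN0)// tN2; lra.
  have q1 : jost_poly' 1 t1 = 0 by rewrite jost_poly'_1 t2 subrr mulr0.
  have [k [k1 sk kE]] := jost_sum_root_diag t101 nR mR al0 q1.
  have qx x : 1 < x -> jost_poly' x t1 != 0.
    by move=> x1; rewrite lt_eqF// (jost_poly'_lt0 t101 (lexx 1) x1)// q1.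
  have [||||T1 T2] := qnone [:: k].
  + by move=> x x1; rewrite tE; split; exact: qx.
  + by [].
  + by move=> x; rewrite inE tE => /eqP ->.
  + by move=> x x1; rewrite tE => /(kE x x1) ->; rewrite inE.
  by [].
Qed.
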